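(* Let $q$ be a central configuration of the Newtonian $n$-body problem in $\mathbb{R}^4$, and let $\gamma$ be the corresponding circular relative equilibrium (RE). Then the following hold. 1. If $q$ is non-planar and Morse-Bott non-degenerate, or if $q$ is arbitrary and Morse-Bott degenerate with $n^0(q)$ even, then $\gamma$ is linearly unstable. 2. Suppose that $$n^-\big(B_3|_{\ker(JB_3)^{8n-8-2\kappa}}\big)\equiv 0\pmod 2,$$ where $\kappa=4$ if $\gamma$ is non-planar, or planar but generated by a collinear central configuration, and $\kappa=6$ otherwise. If $$n^-(q)+n^0(q)\equiv 0\pmod 2,$$ then $\gamma$ is spectrally unstable. In particular (under the same assumption on $B_3$), when $q$ is Morse-Bott non-degenerate: (a) if $q$ is non-planar and $n^-(q)$ is even, then $\gamma$ is spectrally unstable; (b) if $q$ is planar and $n^-(q)$ is odd, then $\gamma$ is spectrally unstable.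
   Context: Newtonian setting: $n\ge 3$ bodies with positions $q_i\in\mathbb{R}^4$ and masses $m_i>0$; $M=\mathrm{diag}(m_1I_4,\dots,m_nI_4)$; $U(q)=\sum_{i<j} m_im_j/|q_i-q_j|$; the equation of motion is $M\ddot q=\nabla U(q)$. $D^2U(q)$ is the Euclidean Hessian. A (normalized) central configuration is $q=(q_1,\dots,q_n)\in\mathbb{R}^{4n}$ with $q_i\ne q_j$ for $i\neq j$, $\sum_i m_iq_i=0$, $\langle Mq,q\rangle=1$ and $\nabla U(q)+U(q)Mq=0$. It is planar (resp. collinear) if all $q_i$ lie in a common linear plane (resp. line) of $\mathbb{R}^4$ (so collinear configurations are planar), and non-planar otherwise. Equivalently, $q$ is a critical point of the restriction $\widehat U$ of $U$ to $\widehat{\mathbb S}=\{q\in\mathbb{R}^{4n}: \sum_i m_iq_i=0,\ \langle Mq,q\rangle=1,\ q_i\ne q_j\ (i\ne j)\}$. Its Hessian is $H(q)=[D^2U(q)+U(q)M]|_{T_q\widehat{\mathbb S}}$; $n^-(q)$ and $n^0(q)$ are the index and nullity of $H(q)$. $q$ is Morse-Bott non-degenerate if $n^0(q)=\dim T_q(\mathrm{SO}(4)\cdot q)$ ($\mathrm{SO}(4)$ acting diagonally), and Morse-Bott degenerate otherwise. Put $k=\sqrt{U(q)}$ and $J_2=\begin{pmatrix}0&-1\\1&0\end{pmatrix}$. Let $K_d$ (resp. $K_s$) be the $4n\times4n$ block-diagonal matrix with $n$ diagonal blocks all equal to $\mathrm{diag}(kJ_2,-kJ_2)$ (resp. $\mathrm{diag}(kJ_2,0)$).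 The circular relative equilibrium (RE) generated by $q$ is the solution $\gamma(t)=e^{tK_d}q$. It is planar if all bodies move in a fixed plane; in that case coordinates of $\mathbb{R}^4$ are taken so that this plane is $\mathbb{R}^2\times\{0\}$, so that $q_j\in\mathbb{R}^2\times\{0\}$ for all $j$ and $\gamma(t)=e^{tK_s}q$. Set $*=d$ if $\gamma$ is non-planar and $*=s$ if $\gamma$ is planar. In rotating coordinates the linearized Hamiltonian system along $\gamma$ is $\dot z=L_*z$ on $\mathbb{R}^{8n}$, with $L_*=\begin{pmatrix}K_*&M^{-1}\\ D^2U(q)&K_*\end{pmatrix}$. In every even dimension $J=\begin{pmatrix}0&-I\\ I&0\end{pmatrix}$ is the standard complex structure and $\omega_0(x,y)=\langle Jx,y\rangle$. Subspaces of $\mathbb{R}^{8n}$: $E_1=\{(v,\dots,v,m_1w,\dots,m_nw): v,w\in\mathbb{R}^4\}$. If $\gamma$ is non-planar, $E_2=\mathrm{span}\{(aq,0),(0,aMq): a\in\{1,\mathbf i,\mathbf j,\mathbf k\}\}$, where $\mathbf i=\begin{pmatrix}0&-1&0&0\\1&0&0&0\\0&0&0&1\\0&0&-1&0\end{pmatrix}$, $\mathbf j=\begin{pmatrix}0&0&1&0\\0&0&0&1\\-1&0&0&0\\0&-1&0&0\end{pmatrix}$, $\mathbf k=\begin{pmatrix}0&0&0&-1\\0&0&1&0\\0&-1&0&0\\1&0&0&0\end{pmatrix}$ act on each of the $n$ blocks $\mathbb{R}^4$. If $\gamma$ is planar, $E_2=\mathrm{span}\{(q,0),(K_{lr}q,0),(0,Mq),(0,MK_{lr}q):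 (l,r)\in\{(1,2),(1,3),(1,4),(2,3),(2,4)\}\}$, where $K_{lr}$ acts on each block $\mathbb{R}^4$ by the matrix with entry $-1$ in position $(l,r)$, $+1$ in position $(r,l)$ and $0$ elsewhere. $E_3$ is the $\omega_0$-orthogonal complement of $E_1\oplus E_2$. These are $L_*$-invariant symplectic subspaces with $\mathbb{R}^{8n}=E_1\oplus E_2\oplus E_3$; $\dim E_3=8n-16$ if $\gamma$ is non-planar or $q$ is collinear, and $\dim E_3=8n-20$ if $\gamma$ is planar and $q$ is non-collinear. $B_3:=JL_3$, where $L_3$ is the matrix of $L_*|_{E_3}$ in a symplectic basis of $E_3$; $B_3$ is symmetric, and the choice of symplectic basis is irrelevant for what follows. $n^-(B|_V)$ is the index (number of negative eigenvalues) of the quadratic form $\langle B\cdot,\cdot\rangle$ restricted to a subspace $V$. $\gamma$ is spectrally stable if all eigenvalues of $JB_3$ are purely imaginary (zero allowed), and linearly stable if in addition $JB_3$ is diagonalizable (over $\mathbb{C}$). Spectrally (resp. linearly) unstable means not spectrally (resp. not linearly) stable. *)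

(* Defs.v *)
From HB Require Import structures.
From mathcomp Require Import all_boot all_order all_algebra.
From mathcomp Require Import all_classical all_reals all_analysis.
From mathcomp Require Import complex mxtens polyrcf.
Set Implicit Arguments.
Unset Strict Implicit.
Unset Printing Implicit Defensive.
Import Order.TTheory GRing.Theory Num.Theory.
Import numFieldNormedType.Exports.
Local Open Scope ring_scope.

Section LinearAlgebra.
Variable R : realType.

(* Vectors are columns and matrices act on the left; kernels and ranges are
   therefore taken on column vectors (mxalgebra's kermx acts on rows). *)
Definition colker m N (A : 'M[R]_(m, N)) : {vspace 'cV[R]_N} :=
  lker (linfun (mulmx A : 'cV[R]_N -> 'cV[R]_m)).

Definition colspan m N (A : 'M[R]_(N, m)) : {vspace 'cV[R]_N} :=
  limg (linfun (mulmx A : 'cV[R]_m -> 'cV[R]_N)).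

Definition dotv N (x y : 'cV[R]_N) : R := \sum_i x i 0 * y i 0.

Definition enorm N (x : 'cV[R]_N) : R := Num.sqrt (dotv x x).

(* Matrix, in the basis [vbasis V], of the quadratic form <B ., .> restricted
   to V. By Sylvester's law the signs of its eigenvalues and its nullity do not
   depend on the basis. *)
Definition form_on N (B : 'M[R]_N) (V : {vspace 'cV[R]_N}) : 'M[R]_(\dim V) :=
  \matrix_(i, j) dotv (B *m tnth (vbasis V) i) (tnth (vbasis V) j).

(* Number of negative eigenvalues, counted with multiplicity. *)
Definition neg_eigenvalues N (A : 'M[R]_N) : nat :=
  (\sum_(a <- rootsR (char_poly A) | (a < 0)%R) mup a (char_poly A))%N.

Definition morse_index N (B : 'M[R]_N) (V : {vspace 'cV[R]_N}) : nat :=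
  neg_eigenvalues (form_on B V).

Definition nullity N (B : 'M[R]_N) (V : {vspace 'cV[R]_N}) : nat :=
  \dim (colker (form_on B V)).

Definition Jstd d : 'M[R]_(d + d) := block_mx 0 (- 1%:M) 1%:M 0.

Definition omega0 d (x y : 'cV[R]_(d + d)) : R := dotv (Jstd d *m x) y.

(* [(Jstd d *m x)^T *m z] is the 1 x 1 matrix with entry [omega0 x z]. *)
Definition omega_orth d (E : {vspace 'cV[R]_(d + d)}) :
    {vspace 'cV[R]_(d + d)} :=
  (\bigcap_(x <- vbasis E) colker ((Jstd d *m x)^T))%VS.

(* The columns of S form a symplectic basis of E. *)
Definition symplectic_basis N d (S : 'M[R]_(N + N, d + d))
    (E : {vspace 'cV[R]_(N + N)}) : Prop :=
  colspan S = E /\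
  forall i j, omega0 (col i S) (col j S) =
              omega0 (delta_mx i 0) (delta_mx j 0 : 'cV[R]_(d + d)).

Local Open Scope classical_set_scope.

Definition expmx N (A : 'M[R]_N) : 'M[R]_N :=
  limn (series (fun k : nat => (k`!%:R)^-1 *: A ^+ k)).

Definition gradient N (f : 'cV[R]_N -> R) (x : 'cV[R]_N) : 'cV[R]_N :=
  \col_i 'D_(delta_mx i 0) f x.

Definition hessian N (f : 'cV[R]_N -> R) (x : 'cV[R]_N) : 'M[R]_N :=
  \matrix_(i, j) 'D_(delta_mx i 0) (fun y => 'D_(delta_mx j 0) f y) x.

End LinearAlgebra.

Section Stability.
Variables (R : realType) (d : nat).
Implicit Type B : 'M[R]_(d + d).

Definition complexify N (A : 'M[R]_N) : 'M[R[i]]_N :=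
  map_mx (real_complex R) A.

Definition spectrally_stable B : Prop :=
  forall z : R[i], eigenvalue (complexify (Jstd R d *m B)) z -> complex.Re z = 0.

Definition linearly_stable B : Prop :=
  spectrally_stable B /\ diagonalizable (complexify (Jstd R d *m B)).

Definition spectrally_unstable B : Prop := ~ spectrally_stable B.
Definition linearly_unstable B : Prop := ~ linearly_stable B.

End Stability.

Section NBody.
Variables (R : realType) (n : nat) (m : 'I_n -> R).
Implicit Type q : 'cV[R]_(n * 4).

Definition body q (j : 'I_n) : 'cV[R]_4 := \col_r q (mxtens_index (j, r)) 0.

(* The block-diagonal 4n x 4n matrix with n diagonal blocks all equal to A. *)
Definition diagonal_action (A : 'M[R]_4) : 'M[R]_(n * 4) := 1%:M *t A.

Definition massmx : 'M[R]_(n * 4) := diag_mx (\row_j m j) *t 1%:M.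

Definition potential q : R :=
  \sum_(i < n) \sum_(j < n | (i < j)%N)
    m i * m j / enorm (body q i - body q j).

Record central_configuration q : Prop := CentralConfiguration {
  cc_collisionless : forall i j, i != j -> body q i != body q j;
  cc_centered : \sum_j m j *: body q j = 0;
  cc_normalized : dotv (massmx *m q) q = 1;
  cc_critical : gradient potential q + potential q *: (massmx *m q) = 0 }.

Definition planar q : Prop :=
  exists P : {vspace 'cV[R]_4}, \dim P = 2%N /\ forall j, body q j \in P.

Definition collinear q : Prop :=
  exists P : {vspace 'cV[R]_4}, \dim P = 1%N /\ forall j, body q j \in P.

(* [repeat_mx *m v] is (v, ..., v). *)
Definition repeat_mx : 'M[R]_(n * 4, 4) := (const_mx 1 : 'cV[R]_n) *t 1%:M.

(* T_q of the sphere {sum_i m_i q_i = 0, <Mq, q> = 1}: the v such that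
   sum_i m_i v_i = 0 and <Mq, v> = 0. *)
Definition tangent_space q : {vspace 'cV[R]_(n * 4)} :=
  (colker (repeat_mx^T *m massmx) :&: colker ((massmx *m q)^T))%VS.

Definition hess_form q : 'M[R]_(n * 4) :=
  hessian potential q + potential q *: massmx.

Definition n_minus q : nat := morse_index (hess_form q) (tangent_space q).
Definition n_zero q : nat := nullity (hess_form q) (tangent_space q).

(* Positions l, r are numbered from 1: entry -1 at (l, r) and +1 at (r, l). *)
Definition Krot (l r : nat) : 'M[R]_4 :=
  \matrix_(a, b) (((a.+1 == r) && (b.+1 == l))%:R
                  - ((a.+1 == l) && (b.+1 == r))%:R).

Definition planar_pairs : seq (nat * nat) :=
  [:: (1, 2); (1, 3); (1, 4); (2, 3); (2, 4)]%N.

(* T_q (SO(4) . q) = so(4) . q, and the six Krot l r form a basis of so(4). *)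
Definition orbit_tangent q : {vspace 'cV[R]_(n * 4)} :=
  <<[seq diagonal_action (Krot p.1 p.2) *m q
       | p <- rcons planar_pairs (3, 4)%N]>>%VS.

Definition morse_bott_nondegenerate q : Prop :=
  n_zero q = \dim (orbit_tangent q).
Definition morse_bott_degenerate q : Prop := ~ morse_bott_nondegenerate q.

Definition J2 : 'M[R]_2 :=
  \matrix_(a, b) (((a == 1%N :> nat) && (b == 0%N :> nat))%:R
                  - ((a == 0%N :> nat) && (b == 1%N :> nat))%:R).

Definition freq q : R := Num.sqrt (potential q).

Definition Kd q : 'M[R]_(n * 4) :=
  diagonal_action
    (block_mx (freq q *: J2) 0 0 (- (freq q *: J2)) : 'M[R]_(2 + 2)).
Definition Ks q : 'M[R]_(n * 4) :=
  diagonal_action (block_mx (freq q *: J2) 0 0 0 : 'M[R]_(2 + 2)).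

Definition RE q (t : R) : 'cV[R]_(n * 4) := expmx (t *: Kd q) *m q.

Definition planar_RE q : Prop :=
  exists P : {vspace 'cV[R]_4},
    \dim P = 2%N /\ forall t j, body (RE q t) j \in P.

Definition in_standard_plane q : Prop :=
  forall (j : 'I_n) (r : 'I_4), (2 <= r)%N -> body q j r 0 = 0.

Definition Kstar q : 'M[R]_(n * 4) :=
  if `[< planar_RE q >] then Ks q else Kd q.

Definition Lstar q : 'M[R]_(n * 4 + n * 4) :=
  block_mx (Kstar q) (invmx massmx) (hessian potential q) (Kstar q).

Definition mx4 (s : seq (seq int)) : 'M[R]_4 :=
  \matrix_(a, b) (nth 0 (nth [::] s a) b)%:~R.

Definition quat_i : 'M[R]_4 := mx4
  [:: [:: 0; -1; 0; 0];
      [:: 1;  0; 0; 0];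
      [:: 0;  0; 0; 1];
      [:: 0;  0; -1; 0]].
Definition quat_j : 'M[R]_4 := mx4
  [:: [:: 0;  0; 1; 0];
      [:: 0;  0; 0; 1];
      [:: -1; 0; 0; 0];
      [:: 0; -1; 0; 0]].
Definition quat_k : 'M[R]_4 := mx4
  [:: [:: 0;  0; 0; -1];
      [:: 0;  0; 1; 0];
      [:: 0; -1; 0; 0];
      [:: 1;  0; 0; 0]].

(* {(v, ..., v, m_1 w, ..., m_n w)} *)
Definition E1 : {vspace 'cV[R]_(n * 4 + n * 4)} :=
  colspan (block_mx repeat_mx 0 0 (massmx *m repeat_mx)).

(* span {(a q, 0), (0, M a q) : a in s}; diagonal actions commute with M. *)
Definition action_span (s : seq 'M[R]_4) q :
    {vspace 'cV[R]_(n * 4 + n * 4)} :=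
  (<<[seq col_mx (diagonal_action a *m q) (0 : 'cV[R]_(n * 4)) | a <- s]>>
   + <<[seq col_mx (0 : 'cV[R]_(n * 4)) (massmx *m (diagonal_action a *m q))
          | a <- s]>>)%VS.

Definition E2 q : {vspace 'cV[R]_(n * 4 + n * 4)} :=
  if `[< planar_RE q >]
  then action_span (1%:M :: [seq Krot p.1 p.2 | p <- planar_pairs]) q
  else action_span [:: 1%:M; quat_i; quat_j; quat_k] q.

Definition E3 q : {vspace 'cV[R]_(n * 4 + n * 4)} := omega_orth (E1 + E2 q)%VS.

(* B3 = J L3, with L3 the matrix of L|E3 in some symplectic basis of E3. *)
Definition is_B3 q d (B3 : 'M[R]_(d + d)) : Prop :=
  exists (S : 'M[R]_(n * 4 + n * 4, d + d)) (L3 : 'M[R]_(d + d)),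
    [/\ symplectic_basis S (E3 q),
        Lstar q *m S = S *m L3
      & B3 = Jstd R d *m L3].

Definition kappa q : nat :=
  if `[< ~ planar_RE q \/ collinear q >] then 4 else 6.

End NBody.

(* Main.v *)
Require Import Defs.
From mathcomp Require Import all_boot all_order all_algebra.
From mathcomp Require Import all_classical all_reals all_analysis.
From mathcomp Require Import complex mxtens polyrcf spectral ring lra zify.
Set Implicit Arguments.
Unset Strict Implicit.
Unset Printing Implicit Defensive.
Import Order.TTheory GRing.Theory Num.Theory.
Import numFieldNormedType.Exports.
Local Open Scope ring_scope.

(* Let B = J L. Because E3 is the omega-orthogonal complement of E1 + E2, its
   elements are the pairs (x, M y) with x, y in Z, the M-orthogonal complement
   of the span X of the translations, of q and of the rotations generating E2.
   As Z is K-invariant, completing the square turns B|E3 into M|Z + (-G)|Z with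
   G = D^2U - K M K. Hence n^-(B3) = n^+(G|Z) and dim ker B3 = dim ker (G|Z).
   The tangent space T_q is the H-orthogonal sum of Z and of the rotations of q
   occurring in X, which are annihilated by H and span an odd-dimensional space
   (3 or 5). If K = K_d then G = H; if K = K_s then G = H on planar variations,
   while on vertical ones the rotation of the (3,4)-plane pairs up the two
   coordinates, so all indices are even there. Therefore
     n^-(B3) = 1 + n^-(q) + n^0(q)  and  dim ker B3 = 1 + n^0(q)   (mod 2).
   On the other hand a symplectic form on the range of a high power of A = J B3
   makes that range even-dimensional, and if A has no nonzero real eigenvalue
   the determinant of B3 there is positive, so its index there is even. *)

(** * Inertia of real symmetric forms *)

(** Planarity enters twice. That of gamma selects K, E2 and the rotations in X. That of [q] fixes
    the dimension of its SO(4)-orbit: 3 or 5 if [q] is planar, 6 otherwise. For Morse-Bott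
    non-degenerate [q] this dimension is n^0(q), and its parity separates cases (a) and (b). Z is
    K-invariant because K sends each generator of E2, up to the factor k, to 0 or to plus or minus
    another one: for K_d since the quaternion units are closed under multiplication by i, for K_s by
    relations that hold on the plane of [q]. The rotation (3,4) is missing from the planar list
    because it annihilates [q]. The constant 1 in both parity formulas comes from dim T_q = 4n - 5
    being odd. On the range of a high power of A, the form B3 is the product of the matrix of A,
    which has no real eigenvalue there, and of an invertible antisymmetric matrix. Both have
    positive determinant, so no normal form of Hamiltonian matrices enters. *)

Lemma sum_count_mem (T : eqType) (P : pred T) (rs s : seq T) :
  uniq rs -> {subset s <= rs} ->
  (\sum_(a <- rs | P a) count_mem a s)%N = count P s.
Proof.
move=> urs; elim: s => [|x s IHs] sub /=; first by rewrite big1.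
rewrite big_split /= IHs => [|y ys]; last by rewrite sub // in_cons ys orbT.
congr (_ + _)%N; rewrite -big_mkcondl /=.
rewrite sum1_count (eq_count (_ : _ =1 predI (pred1 x) P)) //; last first.
  by move=> y /=; rewrite eq_sym.
have /eqP := count_uniq_mem x urs; rewrite sub ?mem_head // => /eqP cx.
case Px: (P x).
  by rewrite -[RHS]cx; apply: eq_count => y /=; case: eqP => // ->; rewrite Px.
rewrite (eq_count (_ : _ =1 pred0)) ?count_pred0 // => y /=.
by case: eqP => // ->; rewrite Px.
Qed.

Section Inertia.
Variable R : realType.

(** The complexification is Hermitian, so the spectral theorem over [R[i]] gives a real eigenvalue;
    it descends to [A] as a root of the real characteristic polynomial. *)
Lemma symmetric_eigenvalue n (A : 'M[R]_n.+1) :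
  A^T = A -> exists a, eigenvalue A a.
Proof.
move=> symA; pose AC := complexify A.
have symAC : AC \is hermsymmx.
  apply: realsym_hermsym.
    apply/is_hermitianmxP; rewrite expr0 scale1r map_mx_id // /AC /complexify.
    by rewrite -[in LHS]symA map_trmx.
  by apply/mxOverP => i j; rewrite mxE; apply/complex_realP; exists (A i j).
have spR := hermitian_spectral_diag_real symAC.
have /orthomx_spectralP eA := hermitian_normalmx symAC.
have Pu := spectral_unit AC.
set P := spectralmx AC in eA Pu; set sp := spectral_diag AC in eA spR.
have ev : eigenvalue AC (sp 0 0).
  apply/eigenvalueP; exists (row 0 P).
    rewrite -row_mul [in LHS]eA !mulmxA mulmxV // mul1mx.
    by rewrite row_mul row_diag_mx -scalemxAl rowE.
  apply/eqP => r0; have := mulmxK Pu (delta_mx 0 0 : 'rV_n.+1).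
  rewrite -rowE r0 mul0mx => /matrixP /(_ 0 0) /eqP.
  by rewrite !mxE !eqxx eq_sym oner_eq0.
have /RRe_real sp00 := mxOverP spR 0 0.
exists (complex.Re (sp 0 0)).
rewrite eigenvalue_root_char -(fmorph_root (real_complex R)) map_char_poly.
rewrite -/(complexify A) -eigenvalue_root_char -/AC.
by rewrite /= sp00.
Qed.

Lemma mxdot_gt0 n (v : 'rV[R]_n) : v != 0 -> 0 < (v *m v^T) 0 0.
Proof.
move=> /rV0Pn[j vj]; rewrite mxE (bigD1 j) //= mxE ltr_pwDl //.
  by rewrite -expr2 exprn_even_gt0.
by apply: sumr_ge0 => i _; rewrite mxE -expr2 sqr_ge0.
Qed.

(* The Householder reflection exchanging the unit vectors v and e_0. *)
Lemma householder n (v : 'rV[R]_n.+1) : (v *m v^T) 0 0 = 1 ->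
  exists H : 'M[R]_n.+1,
    [/\ H^T = H, H *m H = 1%:M & delta_mx 0 0 *m H = v].
Proof.
move=> v1; pose e : 'rV[R]_n.+1 := delta_mx 0 0; pose w := v - e.
have [/eqP|w0] := eqVneq w 0.
  by rewrite subr_eq0 => /eqP ->; exists 1%:M; rewrite trmx1 !mulmx1.
pose s := (w *m w^T) 0 0; have s0 : s != 0 by rewrite gt_eqF // mxdot_gt0.
have ws : w *m w^T = s%:M by rewrite [LHS]mx11_scalar.
have ve : v *m e^T = (v 0 0)%:M.
  by rewrite [LHS]mx11_scalar trmx_delta -colE mxE.
(* As [v] and [e] are unit vectors, |v - e|^2 = 2 - 2 v_0 while <e, v - e> = v_0 - 1; hence the
   reflection along [w] sends [e] to e + w = v. *)
have es : e *m w^T = (- (s / 2))%:M.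
  rewrite [LHS]mx11_scalar; congr _%:M.
  have -> : s = 2 - 2 * v 0 0.
    rewrite /s /w [(v - e)^T]linearB /= mulmxBl !mulmxBr.
    have -> : e *m v^T = v *m e^T.
      by rewrite ve -[LHS]trmxK trmx_mul trmxK ve tr_scalar_mx.
    have -> : e *m e^T = 1%:M.
      by rewrite /e trmx_delta mul_delta_mx [LHS]mx11_scalar mxE !eqxx.
    have -> : v *m v^T = 1%:M by rewrite [LHS]mx11_scalar v1.
    by rewrite ve !mxE !eqxx !mulr1n; ring.
  by rewrite -rowE /w !mxE !eqxx /=; field.
exists (1%:M - (2 / s) *: (w^T *m w)); split.
- by rewrite linearB /= trmx1 linearZ /= trmx_mul trmxK.
- have WW : (w^T *m w) *m (w^T *m w) = s *: (w^T *m w).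
    by rewrite mulmxA -(mulmxA _ w) ws mul_mx_scalar scalemxAl.
  move: (w^T *m w) WW => W WW.
  rewrite mulmxBl mul1mx mulmxBr mulmx1 -scalemxAl -scalemxAr WW !scalerA.
  have -> : 2 / s * (2 / s) * s = 2 / s + 2 / s by field.
  by rewrite scalerDl opprB addrK subrK.
- rewrite [LHS]mulmxBr mulmx1 -scalemxAr mulmxA es mul_scalar_mx scalerA.
  have -> : 2 / s * - (s / 2) = -1 by field.
  by rewrite scaleN1r opprK /w addrC subrK.
Qed.

(** Deflation: conjugating by a reflection that moves a unit eigenvector to e_0 makes the first row
    a multiple of e_0, and symmetry then leaves a smaller diagonal block. The rows of [P] are
    eigenvectors. *)
Lemma spectral_symmetric n (A : 'M[R]_n) : A^T = A ->
  exists (P : 'M[R]_n) (d : 'rV[R]_n),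
    P *m P^T = 1%:M /\ A = P^T *m diag_mx d *m P.
Proof.
elim: n A => [|n IHn] A symA.
  by exists 1%:M, 0; split; apply/matrixP => - [].
have [a /eigenvalueP[v vA v0]] := symmetric_eigenvalue symA.
move: A symA v vA v0; rewrite -[n.+1]/(1 + n)%N => A symA v vA v0.
wlog v1 : v vA v0 / (v *m v^T) 0 0 = 1 => [hw|].
  have v2 := mxdot_gt0 v0; set s := (v *m v^T) 0 0 in v2.
  have r0 : Num.sqrt s != 0 by rewrite gt_eqF // sqrtr_gt0.
  apply: (hw ((Num.sqrt s)^-1 *: v)).
  - by rewrite -scalemxAl vA !scalerA mulrC.
  - by rewrite scaler_eq0 invr_eq0 negb_or r0.
  - rewrite linearZ /= -scalemxAl -scalemxAr scalerA mxE -/s -invfM.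
    by rewrite -expr2 sqr_sqrtr ?ltW // mulVf // gt_eqF.
have [H [symH HH eH]] : exists H : 'M[R]_(1 + n),
  [/\ H^T = H, H *m H = 1%:M & delta_mx 0 0 *m H = v] := householder v1.
pose B := H *m A *m H.
have symB : B^T = B by rewrite /B !trmx_mul symA symH mulmxA.
have B0 : row 0 B = a *: delta_mx 0 0.
  by rewrite rowE /B !mulmxA eH vA -scalemxAl -eH -mulmxA HH mulmx1.
have Bur : ursubmx B = 0.
  apply/matrixP => i j; transitivity (row 0 B 0 (rshift 1 j)).
    by rewrite [LHS]mxE [LHS]mxE [RHS]mxE; congr (B _ _); apply: val_inj; rewrite ord1.
  by rewrite B0 !mxE /= mulr0.
have Bdl : dlsubmx B = 0 by rewrite -symB -trmx_ursub Bur trmx0.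
have /IHn[P [d [PP dP]]] : (drsubmx B)^T = drsubmx B.
  by rewrite trmx_drsub symB.
exists (block_mx 1%:M 0 0 P *m H), (row_mx (ulsubmx B 0 0)%:M d); split.
  rewrite trmx_mul symH mulmxA -(mulmxA _ H H) HH mulmx1 tr_block_mx mulmx_block.
  by rewrite !trmx0 trmx1 !mulmx0 !mul0mx !addr0 add0r mulmx1 PP -scalar_mx_block.
have -> : A = H *m B *m H.
  by rewrite /B !mulmxA HH mul1mx -mulmxA HH mulmx1.
rewrite trmx_mul symH -!mulmxA; congr (_ *m _); rewrite !mulmxA; congr (_ *m _).
rewrite -[LHS](@submxK _ 1 n 1 n) Bur Bdl diag_mx_row tr_block_mx !mulmx_block.
rewrite !trmx0 trmx1 !(mulmx0, mul0mx, addr0, add0r, mulmx1, mul1mx) -dP.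
by congr block_mx; apply/matrixP => i j; rewrite !ord1 !mxE /= !mulr1n.
Qed.

Lemma diag_form n (d y : 'rV[R]_n) :
  (y *m diag_mx d *m y^T) 0 0 = \sum_i d 0 i * y 0 i ^+ 2.
Proof.
rewrite mxE; apply: eq_bigr => i _.
by rewrite mul_mx_diag !mxE; ring.
Qed.

Lemma char_poly_conj n (P Q A : 'M[R]_n) :
  P *m Q = 1%:M -> char_poly (Q *m A *m P) = char_poly A.
Proof.
move=> PQ; have QP := mulmx1C PQ; rewrite /char_poly.
have -> : char_poly_mx (Q *m A *m P) =
    map_mx polyC Q *m char_poly_mx A *m map_mx polyC P.
  rewrite /char_poly_mx mulmxBr mulmxBl -!map_mxM; congr (_ - _).
  by rewrite -mulmxA -scalar_mxC mulmxA -map_mxM QP map_mx1 mul1mx.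
rewrite !det_mulmx mulrAC -det_mulmx -map_mxM QP map_mx1 det1 mul1r //.
Qed.

Lemma neg_eigenvalues_diag n (P : 'M[R]_n) (d : 'rV[R]_n) :
  P *m P^T = 1%:M ->
  neg_eigenvalues (P^T *m diag_mx d *m P) = #|[pred i | d 0 i < 0]|.
Proof.
move=> PP; rewrite /neg_eigenvalues char_poly_conj //.
have -> : char_poly (diag_mx d) = \prod_(y <- [seq d 0 i | i <- enum 'I_n]) ('X - y%:P).
  rewrite char_poly_trig ?diag_mx_is_trig // big_map big_enum /=.
  by apply: eq_bigr => i _; rewrite mxE eqxx mulr1n.
set s := [seq _ | _ <- _]; set p := \prod_(y <- s) _.
have p0 : p != 0 by rewrite monic_neq0 // monic_prod_XsubC.
have sr x : x \in s -> x \in rootsR p.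
  by rewrite -(roots_on_rootsR p0) in_itv /= root_prod_XsubC.
(* The multiplicity of a root is its number of occurrences among the diagonal entries, so the sum
   over distinct roots becomes a count. *)
rewrite (eq_bigr (fun a => count_mem a s)); last by move=> a _; rewrite mu_prod_XsubC.
have ur : uniq (rootsR p) by apply: uniq_roots. 
rewrite sum_count_mem // count_map cardE enumT size_filter.
exact: eq_count.
Qed.

(* The vectors of the negative space of W A W^T whose images have no component
   along the negative eigenvectors of A satisfy x A x^T >= 0, so that space
   injects into the negative space of A. *)
Lemma neg_eigenvalues_congr_le N k (A : 'M[R]_N) (W : 'M[R]_(k, N)) :
  A^T = A -> (neg_eigenvalues (W *m A *m W^T) <= neg_eigenvalues A)%N.
Proof.
move=> symA; have [P [d [PP ->]]] := spectral_symmetric symA.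
have PP' := mulmx1C PP; set A' := P^T *m _ *m P.
have /spectral_symmetric[P' [d' [PP1 eB]]] : (W *m A' *m W^T)^T = W *m A' *m W^T.
  by rewrite /A' !trmx_mul !trmxK tr_diag_mx !mulmxA.
rewrite eB !neg_eigenvalues_diag //.
set I' := [pred i | d' 0 i < 0]; set I := [pred i | d 0 i < 0].
pose f' (j : 'I_#|I'|) := enum_val j; pose f (j : 'I_#|I|) := enum_val j.
pose U := rowsub f' P'; pose Z := U *m W *m colsub f P^T.
(* [Z] reads the components of the image of the negative space along the negative eigenvectors of
   [A]; it has [#|I'|] rows and [#|I|] columns. *)
suff : row_free Z by move=> /eqP <-; apply: rank_leq_col.
apply: inj_row_free => c cZ; apply/eqP/contraT => c0.
pose x := c *m U *m W.
have : (x *m A' *m x^T) 0 0 < 0.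
  have -> : x *m A' *m x^T = c *m diag_mx (\row_j d' 0 (f' j)) *m c^T.
    transitivity (c *m (U *m (W *m A' *m W^T) *m U^T) *m c^T).
      by rewrite /x !trmx_mul !mulmxA.
    congr (_ *m _ *m _); rewrite eB /U trmx_mxsub !mul_rowsub_mx mulmx_colsub.
    rewrite !mulmxA PP1 mul1mx -mulmxA PP1 mulmx1.
    by apply/matrixP => i j; rewrite !mxE (inj_eq enum_val_inj).
  rewrite diag_form; have /rV0Pn[j cj] := c0.
  rewrite (bigD1 j) //= mxE -oppr_gt0 opprD ltr_pwDl //.
    rewrite -mulNr mulr_gt0 ?exprn_even_gt0 // oppr_gt0.
    exact: (enum_valP j).
  rewrite -sumrN sumr_ge0 // => i _; rewrite mxE -mulNr mulr_ge0 ?sqr_ge0 //.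
  by rewrite oppr_ge0 ltW //; apply: (enum_valP i).
suff : 0 <= (x *m A' *m x^T) 0 0 by rewrite leNgt => /negbTE ->.
have -> : x *m A' *m x^T = (x *m P^T) *m diag_mx d *m (x *m P^T)^T.
  by rewrite /A' [(x *m P^T)^T]trmx_mul trmxK !mulmxA.
rewrite diag_form; apply: sumr_ge0 => i _.
have [di|] := boolP (d 0 i < 0); last by rewrite -leNgt => di; rewrite mulr_ge0 ?sqr_ge0.
have -> : (x *m P^T) 0 i = 0; last by rewrite expr0n /= mulr0.
have Ii : i \in I by [].
have /rowP /(_ (enum_rank_in Ii i)) := cZ.
by rewrite /Z !mulmxA mulmx_colsub !mxE /f enum_rankK_in.
Qed.

(** Index of the form [A] on the row space of [W]. Dependent rows only add zero eigenvalues, and by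
    [ind_eqmx] the value depends on the row space alone. *)
Definition ind N k (A : 'M[R]_N) (W : 'M[R]_(k, N)) : nat :=
  neg_eigenvalues (W *m A *m W^T).

Lemma trmx_congr N k (A : 'M[R]_N) (W : 'M[R]_(k, N)) :
  A^T = A -> (W *m A *m W^T)^T = W *m A *m W^T.
Proof. by move=> symA; rewrite !trmx_mul trmxK symA mulmxA. Qed.

Lemma ind_sub N k1 k2 (A : 'M[R]_N) (W1 : 'M[R]_(k1, N)) (W2 : 'M[R]_(k2, N)) :
  A^T = A -> (W1 <= W2)%MS -> (ind A W1 <= ind A W2)%N.
Proof.
move=> symA /submxP[X ->]; rewrite /ind.
have -> : X *m W2 *m A *m (X *m W2)^T = X *m (W2 *m A *m W2^T) *m X^T.
  by rewrite trmx_mul !mulmxA.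
by apply: neg_eigenvalues_congr_le; rewrite trmx_congr.
Qed.

Lemma ind_eqmx N k1 k2 (A : 'M[R]_N) (W1 : 'M[R]_(k1, N)) (W2 : 'M[R]_(k2, N)) :
  A^T = A -> (W1 :=: W2)%MS -> ind A W1 = ind A W2.
Proof.
by move=> symA eW; apply/eqP; rewrite eqn_leq !ind_sub // eW.
Qed.

Lemma neg_eigenvalues_block m n (A : 'M[R]_m) (B : 'M[R]_n) :
  A^T = A -> B^T = B ->
  neg_eigenvalues (block_mx A 0 0 B) =
  (neg_eigenvalues A + neg_eigenvalues B)%N.
Proof.
move=> /spectral_symmetric[P [d [PP ->]]] /spectral_symmetric[Q [e [QQ ->]]].
rewrite !neg_eigenvalues_diag //.
have -> : block_mx (P^T *m diag_mx d *m P) 0 0 (Q^T *m diag_mx e *m Q) =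
    (block_mx P 0 0 Q)^T *m diag_mx (row_mx d e) *m block_mx P 0 0 Q.
  rewrite diag_mx_row tr_block_mx !mulmx_block !trmx0.
  by rewrite !(mulmx0, mul0mx, addr0, add0r).
rewrite neg_eigenvalues_diag; last first.
  rewrite tr_block_mx mulmx_block !trmx0 !(mulmx0, mul0mx, addr0, add0r) PP QQ.
  by rewrite -scalar_mx_block.
rewrite -!sum1_card big_split_ord /=; congr (_ + _)%N; apply: eq_bigl => i.
  by rewrite !inE row_mxEl.
by rewrite !inE row_mxEr.
Qed.

Lemma ind_col_mx N k1 k2 (A : 'M[R]_N) (W1 : 'M[R]_(k1, N)) (W2 : 'M[R]_(k2, N)) :
  A^T = A -> W1 *m A *m W2^T = 0 ->
  ind A (col_mx W1 W2) = (ind A W1 + ind A W2)%N.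
Proof.
move=> symA W12; have W21 : W2 *m A *m W1^T = 0.
  by apply/trmx_inj; rewrite !trmx_mul trmxK symA mulmxA W12 trmx0.
rewrite /ind tr_col_mx mul_col_mx mul_col_row W12 W21.
by rewrite neg_eigenvalues_block // trmx_congr.
Qed.

(** Selecting and embedding coordinates makes [diag_mx d] and the invertible diagonal matrix of its
    nonzero entries factor through each other. *)
Lemma rank_diag_mx n (d : 'rV[R]_n) : \rank (diag_mx d) = #|[pred i | d 0 i != 0]|.
Proof.
set I := [pred i | _]; pose f (j : 'I_#|I|) := enum_val j.
pose d' : 'rV[R]_#|I| := \row_j d 0 (f j).
have rd' : \rank (diag_mx d') = #|I|.
  apply/eqP; rewrite -[_ == _]/(row_free _) row_free_unit unitmxE det_diag unitfE.
  by apply/prodf_neq0 => i _; rewrite mxE; apply: (enum_valP i).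
have e1 : diag_mx d' = rowsub f 1%:M *m diag_mx d *m colsub f 1%:M.
  rewrite mul_rowsub_mx mulmx_colsub mulmx1 mul1mx.
  by apply/matrixP => i j; rewrite !mxE (inj_eq enum_val_inj).
have e2 : diag_mx d = colsub f 1%:M *m diag_mx d' *m rowsub f 1%:M.
  apply/matrixP => i j; rewrite mul_mx_diag !mxE.
  have [Ii|nIi] := boolP (i \in I).
    rewrite (bigD1 (enum_rank_in Ii i)) //= !mxE /f enum_rankK_in // eqxx mul1r.
    rewrite -mulr_natr big1 ?addr0 // => k kn; rewrite !mxE.
    case: eqP => [ik|_]; last by rewrite !mul0r.
    by case/negP: kn; rewrite {2}ik enum_valK_in.
  rewrite big1 => [|k _]; last first.
    rewrite !mxE; case: eqP => [ik|_]; last by rewrite !mul0r.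
    by rewrite ik enum_valP in nIi.
  by move: nIi; rewrite inE negbK => /eqP ->; rewrite mul0rn.
apply/eqP; rewrite eqn_leq; apply/andP; split.
  rewrite e2; apply: leq_trans (mxrankM_maxl _ _) _.
  by apply: leq_trans (mxrankM_maxr _ _) _; rewrite rd'.
apply: (@leq_trans (\rank (diag_mx d'))); first by rewrite rd'.
by rewrite e1; apply: leq_trans (mxrankM_maxl _ _) (mxrankM_maxr _ _).
Qed.

Lemma rank_congr_unit n (P A : 'M[R]_n) : P *m P^T = 1%:M ->
  \rank (P^T *m A *m P) = \rank A.
Proof.
move=> PP; have PTu : P^T \in unitmx by have /mulmx1_unit[] := PP.
have Pu : P \in unitmx by have /mulmx1_unit[] := PP.
by rewrite mxrankMfree ?row_free_unit // -mxrank_tr trmx_mul trmxK mxrankMfree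
  ?row_free_unit // mxrank_tr.
Qed.

(** Positive eigenvalues are counted as negative ones of [- A], so a single index function also
    governs ranks. *)
Lemma rank_neg_eigenvalues n (A : 'M[R]_n) : A^T = A ->
  \rank A = (neg_eigenvalues A + neg_eigenvalues (- A))%N.
Proof.
move=> /spectral_symmetric[P [d [PP ->]]].
have -> : - (P^T *m diag_mx d *m P) = P^T *m diag_mx (- d) *m P.
  by rewrite linearN /= mulmxN mulNmx.
rewrite rank_congr_unit // !neg_eigenvalues_diag // rank_diag_mx.
rewrite -!sum1_card [LHS]big_mkcond [X in (X + _)%N]big_mkcond.
rewrite [X in (_ + X)%N]big_mkcond -big_split /=; apply: eq_bigr => i _.
by rewrite !inE mxE oppr_lt0; case: (ltgtP (d 0 i) 0).
Qed.

Lemma rank_ind N k (A : 'M[R]_N) (W : 'M[R]_(k, N)) : A^T = A ->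
  \rank (W *m A *m W^T) = (ind A W + ind (- A) W)%N.
Proof.
by move=> symA; rewrite (rank_neg_eigenvalues (trmx_congr W symA)) /ind mulmxN mulNmx.
Qed.

Lemma neg_eigenvalues_posdef n (A : 'M[R]_n) : A^T = A ->
  (forall x : 'rV[R]_n, 0 <= (x *m A *m x^T) 0 0) -> neg_eigenvalues A = 0%N.
Proof.
move=> /spectral_symmetric[P [d [PP ->]]] A0; rewrite neg_eigenvalues_diag //.
apply: eq_card0 => i; rewrite inE; apply/negbTE; rewrite -leNgt.
have rP : row i P *m P^T = row i 1%:M by rewrite -row_mul PP.
have := A0 (row i P).
have -> : row i P *m (P^T *m diag_mx d *m P) *m (row i P)^T =
    row i 1%:M *m diag_mx d *m (row i 1%:M)^T.
  by rewrite -rP trmx_mul trmxK !mulmxA.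
rewrite diag_form (bigD1 i) //= !mxE eqxx expr1n mulr1 big1 ?addr0 //.
by move=> j ji; rewrite !mxE eq_sym (negbTE ji) expr0n mulr0.
Qed.

Lemma odd_neg_eigenvalues n (A : 'M[R]_n) : A^T = A ->
  0 < \det A -> ~~ odd (neg_eigenvalues A).
Proof.
move=> /spectral_symmetric[P [d [PP ->]]].
rewrite !det_mulmx det_tr mulrAC -expr2 => dA; rewrite neg_eigenvalues_diag //.
have dd : 0 < \prod_i d 0 i.
  rewrite -det_diag; move: dA; rewrite pmulr_rgt0 // exprn_even_gt0 //=.
  by rewrite -unitfE -unitmxE; have /mulmx1_unit[] := PP.
have dE : \prod_i d 0 i = (-1) ^+ #|[pred i | d 0 i < 0]| * \prod_i `|d 0 i|.
  rewrite -sum1_card [X in (-1) ^+ X]big_mkcond /= expr_sum -big_split /=.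
  apply: eq_bigr => i _; rewrite inE [LHS]realEsign ?num_real //.
apply: contraL dd => oddn; rewrite dE -signr_odd oddn expr1 mulN1r oppr_gt0 -leNgt.
by apply: prodr_ge0.
Qed.

End Inertia.

(** * Real spectrum and parity of the index *)

Section Stability.
Variable R : realType.

Lemma submx_exp_step n (A : 'M[R]_n) k l :
  (A ^+ k <= A ^+ k.+1)%MS -> (A ^+ (k + l) <= A ^+ (k + l).+1)%MS.
Proof.
by move=> /submxP[X e]; rewrite -addSn !exprD -!mulmxE {1}e -mulmxA submxMl.
Qed.

(** If the decreasing chain of row spaces had no stationary step up to [n], the rank would drop
    [n.+1] times starting from [n]. *)
Lemma submx_exp_stable n (A : 'M[R]_n) k l :
  (n <= k)%N -> (A ^+ k <= A ^+ (k + l))%MS.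
Proof.
move=> nk; have step j : (A ^+ (n + j) <= A ^+ (n + j).+1)%MS.
  have [[i lein si]|ns] :=
    pselect (exists2 i, (i <= n)%N & (A ^+ i <= A ^+ i.+1)%MS).
    have -> : (n + j = i + (n - i + j))%N by rewrite addnA subnKC.
    exact: submx_exp_step.
  have rk i : (i <= n.+1)%N -> (\rank (A ^+ i) + i <= n)%N.
    elim: i => [|i IHi] lin; first by rewrite addn0 rank_leq_row.
    rewrite addnS; apply: leq_trans (IHi (ltnW lin)); rewrite ltn_add2r.
    have sub : (A ^+ i.+1 <= A ^+ i)%MS by rewrite exprS -mulmxE submxMl.
    rewrite (ltn_leqif (mxrank_leqif_sup sub)).
    by apply/negP => si; apply: ns; exists i.
  by have := rk n.+1 (leqnn _); rewrite addnS ltnNge leq_addl.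
elim: l => [|l IHl]; first by rewrite addn0.
rewrite addnS; apply: submx_trans IHl _.
by have := step (k - n + l)%N; rewrite addnA subnKC.
Qed.

(** The characteristic polynomial of [- A] equals [\det A] at 0 and is at least 1 far to the right;
    a nonpositive value at 0 would give a real root, hence a real eigenvalue of [A]. *)
Lemma det_gt0_noeigen n (A : 'M[R]_n) :
  (forall x, ~~ eigenvalue A x) -> 0 < \det A.
Proof.
move=> noev; pose p := char_poly (- A).
have p0 : p.[0] = \det A.
  rewrite horner_coef0 char_poly_det -(scaleN1r A) detZ mulrA -exprD -signr_odd.
  by rewrite addnn odd_double expr0 mul1r.
have nr x : ~~ root p x.
  rewrite -eigenvalue_root_char; apply: contra (noev (- x)).
  move=> /eigenvalueP[v vA v0]; apply/eigenvalueP; exists v => //.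
  by rewrite scaleNr -vA mulmxN opprK.
have [b hb] : exists b, forall x, b <= x -> lead_coef p <= p.[x].
  by apply: poly_pinfty_gt_lc; rewrite (monicP (char_poly_monic _)) ltr01.
rewrite (monicP (char_poly_monic _)) in hb.
rewrite -p0 ltNge; apply/negP => pneg.
pose c := Num.max 0 b; have c0 : 0 <= c by rewrite le_max lexx.
have [x _ rx] : exists2 x, x \in `[0, c] & root p x.
  apply: poly_ivt => //; rewrite pneg (le_trans ler01) // hb //.
  by rewrite le_max lexx orbT.
by have := nr x; rewrite rx.
Qed.

(** A real eigenvalue x with eigenvector v satisfies x |v|^2 = v A v^T = 0, so x = 0, against
    freeness: there is no real eigenvalue. *)
Lemma det_gt0_antisym n (A : 'M[R]_n) : A^T = - A -> row_free A -> 0 < \det A.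
Proof.
move=> aA fA; apply: det_gt0_noeigen => x; apply/negP.
move=> /eigenvalueP[v vA v0].
have vAv : (v *m A *m v^T) 0 0 = 0.
  have : (v *m A *m v^T)^T = - (v *m A *m v^T).
    by rewrite !trmx_mul trmxK aA mulNmx mulmxN mulmxA.
  by move=> /matrixP /(_ 0 0); rewrite mxE [RHS]mxE => /eqP; lra.
move: vAv; rewrite vA -scalemxAl mxE => /eqP; rewrite mulf_eq0.
rewrite (gt_eqF (mxdot_gt0 v0)) orbF => /eqP x0.
move: vA; rewrite x0 scale0r -(mul0mx _ A) => /(row_free_inj fA) /eqP.
by rewrite (negbTE v0).
Qed.

(** In odd dimension det A = det A^T = - det A. *)
Lemma antisym_even n (A : 'M[R]_n) : A^T = - A -> row_free A -> ~~ odd n.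
Proof.
move=> aA fA; have dA := det_gt0_antisym aA fA; apply/negP => on.
have := congr1 determinant aA; rewrite det_tr -(scaleN1r A) detZ -signr_odd on.
by rewrite expr1 mulN1r => /eqP; rewrite -addr_eq0 gt_eqF // addr_gt0.
Qed.

Lemma eigenvalue_tr n (M : 'M[R]_n) x : eigenvalue M^T x = eigenvalue M x.
Proof.
rewrite /eigenvalue /eigenspace !kermx_eq0 !row_free_unit -[in RHS]unitmx_tr.
by rewrite [in RHS]linearB /= tr_scalar_mx.
Qed.

Lemma Jstd_tr d : (Jstd R d)^T = - Jstd R d.
Proof.
by rewrite /Jstd tr_block_mx opp_block_mx !trmx0 trmx1 linearN /= trmx1 oppr0 opprK.
Qed.

Lemma Jstd_sq d : Jstd R d *m Jstd R d = - 1%:M.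
Proof.
rewrite /Jstd mulmx_block !(mulmx0, mul0mx, addr0, add0r) mulmx1 mul1mx.
by rewrite scalar_mx_block opp_block_mx !oppr0.
Qed.

Lemma Jstd_unit d : Jstd R d \in unitmx.
Proof.
have /mulmx1_unit[] // : Jstd R d *m - Jstd R d = 1%:M.
by rewrite mulmxN Jstd_sq opprK.
Qed.

Variables (d : nat) (B : 'M[R]_(d + d)).
Hypothesis symB : B^T = B.
Let J := Jstd R d.
Let A := J *m B.

Lemma trA_J : A^T *m J = B.
Proof.
by rewrite /A trmx_mul symB Jstd_tr mulmxN mulNmx -mulmxA Jstd_sq mulmxN opprK mulmx1.
Qed.

Lemma J_A : J *m A = - B.
Proof. by rewrite /A mulmxA Jstd_sq mulNmx mul1mx. Qed.

(** Iterates the Hamiltonian relation J A = - A^T J. The scalar is the sign (-1)^e, of which only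
    the nonvanishing matters. *)
Lemma J_expA e : exists2 s : R, s != 0 & J *m A ^+ e = s *: (A^T ^+ e *m J).
Proof.
elim: e => [|e [s s0 IHe]].
  by exists 1; rewrite ?oner_eq0 // !expr0 scale1r mulmx1 mul1mx.
exists (- s); rewrite ?oppr_eq0 //.
rewrite exprSr -[_ * _]/(_ *m _) mulmxA IHe -scalemxAl scaleNr -scalerN.
congr (_ *: _); rewrite exprSr -[_ * _]/(_ *m _) -!mulmxA trA_J J_A.
by rewrite mulmxN.
Qed.

Lemma B_expA e : exists s : R, B *m A ^+ e = s *: (A^T ^+ e *m B).
Proof.
have [s _ h] := J_expA e; exists s.
rewrite -{1}trA_J -mulmxA h -scalemxAr mulmxA -[A^T *m _]/(A^T * _) -exprS exprSr.
by rewrite -[_ * _]/(_ *m _) -mulmxA trA_J.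
Qed.

Lemma trmx_exp n (M : 'M[R]_n) e : (M ^+ e)^T = M^T ^+ e.
Proof.
elim: e => [|e IHe]; first by rewrite !expr0 trmx1.
by rewrite exprS exprSr -[M * _]/(M *m _) trmx_mul IHe.
Qed.

Variable e : nat.
Hypothesis de : (d + d <= e)%N.
(** Transposed so that the row spaces [kermx F] and [F] are the column kernel and the column range
    of [A ^+ e]. *)
Let F := A^T ^+ e.

Lemma trF : F^T = A ^+ e.
Proof. by rewrite /F -trmx_exp trmxK. Qed.

(** From the power [d + d] on the row spaces are stationary, so F and F^2 have the same rank and
    therefore the same kernel. *)
Lemma fitting_disjoint k (X : 'M[R]_(k, d + d)) :
  (X <= F)%MS -> X *m F = 0 -> X = 0.
Proof.
move=> /submxP[Y ->]; have /submxP[Z FZ] : (F <= F *m F)%MS.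
  by rewrite /F -[_ *m _]/(_ * _) -exprD submx_exp_stable.
have rFF : \rank (F *m F) = \rank F.
  by apply/eqP; rewrite eqn_leq mxrankM_maxl /= {1}FZ mxrankM_maxr.
have sub : (kermx F <= kermx (F *m F))%MS.
  by apply/sub_kermxP; rewrite mulmxA mulmx_ker mul0mx.
have : (kermx (F *m F) <= kermx F)%MS.
  by rewrite -(geq_leqif (mxrank_leqif_sup sub)) !mxrank_ker rFF.
move=> h YF; apply/sub_kermxP; apply: submx_trans h; apply/sub_kermxP.
by rewrite mulmxA.
Qed.

Lemma fitting_sum : (kermx F + F :=: 1%:M)%MS.
Proof.
have dis : (kermx F :&: F)%MS = 0.
  apply: (fitting_disjoint (capmxSr _ _)). exact/sub_kermxP/capmxSl.
apply/eqmxP; rewrite submx1 sub1mx /row_full.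
rewrite (mxrank_disjoint_sum dis) mxrank_ker subnK ?eqxx //.
exact: rank_leq_row.
Qed.

Lemma ker_exp k (X : 'M[R]_(k, d + d)) : X *m A^T = 0 -> X *m F = 0.
Proof.
rewrite /F; case: (e) de => [|l] de' XA.
  (* A zero exponent forces [d + d = 0], and the matrices have no columns. *)
  by apply/matrixP => i j; have := ltn_ord j; lia.
by rewrite exprS -[_ * _]/(_ *m _) mulmxA XA mul0mx.
Qed.

Let Y := row_base F.
(** Gram matrix of the symplectic form on the range of [A ^+ e]. *)
Let Om := Y *m J *m Y^T.

(** A vector of the range that is symplectically orthogonal to the range is killed by [F], because
    [J] intertwines A^e and F up to a nonzero scalar; Fitting disjointness makes it zero. *)
Lemma Om_free : row_free Om.
Proof.
apply: inj_row_free => c cO.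
have sx : (c *m Y <= F)%MS by rewrite (submx_trans (submxMl _ _)) ?eq_row_base.
have : c *m Y *m J *m F^T = 0.
  have /submxP[X eX] : (F <= Y)%MS by rewrite eq_row_base.
  have -> : F^T = Y^T *m X^T by rewrite -trmx_mul -eX.
  have -> : c *m Y *m J *m (Y^T *m X^T) = c *m Om *m X^T by rewrite /Om !mulmxA.
  by rewrite cO mul0mx.
rewrite trF; have [s s0 h] := J_expA e; rewrite -mulmxA h.
rewrite -scalemxAr => /eqP; rewrite scaler_eq0 (negbTE s0) /= mulmxA => /eqP h2.
have /(fitting_disjoint sx) : c *m Y *m F = 0.
  by rewrite -(mulmxK (Jstd_unit d) (_ *m F)) h2 mul0mx.
by rewrite -(mul0mx _ Y) => /(row_free_inj (row_base_free F)).
Qed.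

Lemma Om_anti : Om^T = - Om.
Proof.
rewrite /Om (trmx_mul (Y *m J)) (trmx_mul Y) trmxK Jstd_tr mulNmx mulmxN.
by rewrite mulmxA.
Qed.

Lemma fitting_rank_even : ~~ odd (\rank F).
Proof. exact: antisym_even Om_anti Om_free. Qed.

(** Kernel and range of A^e are [B]-orthogonal, so the indices add. On the range, [B] has Gram
    matrix [C *m Om], where [C] represents [A]: a nonzero real eigenvalue of [C] is excluded by
    hypothesis, and 0 because [A] is injective on the range. Both determinants are thus positive and
    the index there is even. *)
Lemma odd_neg_eigenvalues_fitting :
  (forall x, eigenvalue A x -> x = 0) ->
  odd (neg_eigenvalues B) = odd (ind B (kermx F)).
Proof.
move=> ev.
have -> : neg_eigenvalues B = ind B (col_mx (kermx F) F).
  transitivity (ind B (1%:M : 'M[R]_(d + d))); first by rewrite /ind trmx1 mulmx1 mul1mx.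
  apply: ind_eqmx => //; apply: eqmx_sym; apply: eqmx_trans fitting_sum.
  exact/eqmx_sym/addsmxE.
rewrite ind_col_mx //; last first.
  have [s h] := B_expA e; rewrite trF -mulmxA h -scalemxAr mulmxA.
  by rewrite mulmx_ker mul0mx scaler0.
rewrite oddD (ind_eqmx symB (eqmx_sym (eq_row_base F))) -/Y.
suff -> : odd (ind B Y) = false by rewrite addbF.
apply/negbTE/odd_neg_eigenvalues; first by rewrite trmx_congr.
have /submxP[C YC] : (Y *m A^T <= Y)%MS.
  rewrite eq_row_base (eqmxMr _ (eq_row_base F)).
  by rewrite /F -[_ *m _]/(_ * _) -exprSr exprS submxMl.
have -> : Y *m B *m Y^T = C *m Om.
  by rewrite -trA_J /Om (mulmxA Y) YC !mulmxA.
rewrite det_mulmx.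
rewrite mulr_gt0 ?(det_gt0_antisym Om_anti Om_free) //.
apply: det_gt0_noeigen => x; apply/eigenvalueP => -[v vC v0].
have vY0 : v *m Y != 0.
  apply: contra v0 => /eqP; rewrite -(mul0mx _ Y).
  by move=> /(row_free_inj (row_base_free F)) ->.
have vA : v *m Y *m A^T = x *: (v *m Y).
  by rewrite -mulmxA YC mulmxA vC scalemxAl.
have x0 : x = 0.
  by apply: ev; rewrite -eigenvalue_tr; apply/eigenvalueP; exists (v *m Y).
have vF : v *m Y *m F = 0 by apply: ker_exp; rewrite vA x0 scale0r.
have sx : (v *m Y <= F)%MS by rewrite (submx_trans (submxMl _ _)) ?eq_row_base.
by rewrite (fitting_disjoint sx vF) eqxx in vY0.
Qed.
End Stability.

Lemma rank_exp_diagonalizable (F : fieldType) n (A : 'M[F]_n) e :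
  diagonalizable A -> \rank (A ^+ e.+1) = \rank A.
Proof.
move=> [P Pu /(diagonalizable_forLR Pu)[D eA]].
(* Since the inverse of 0 is 0, [X] inverts [A] on its range and vanishes on its kernel; A = X A^2
   then prevents the rank of powers from dropping. *)
pose X := invmx P *m diag_mx (\row_i (D 0 i)^-1) *m P.
have eX : A = X *m (A *m A).
  rewrite eA mxpoly.conjVmx // /X !mulmxA !(mulmxKV Pu, mulmxK Pu).
  congr (_ *m _); rewrite -!mulmxA; congr (_ *m _); apply/matrixP => i j.
  rewrite !mul_diag_mx !mxE; have [->|d0] := eqVneq (D 0 i) 0.
    by rewrite !mul0rn !mulr0.
  by rewrite mulKf.
apply/eqP; rewrite eqn_leq exprS -[A * _]/(A *m _) mxrankM_maxl /=.
elim: e => [|e IHe]; first by rewrite expr0 mulmx1.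
have -> : A *m A ^+ e.+1 = A *m (A *m A ^+ e) by rewrite exprS.
apply: leq_trans IHe _; rewrite {1}eX -(mulmxA X) -(mulmxA A).
exact: mxrankM_maxr.
Qed.

(** * Subspaces of columns as row spaces, and the two stability criteria *)

Section Bridge.
Variable R : realType.

(** Transports the column subspaces of the statement into the calculus of row spaces, with
    [sub_vsrows] as dictionary. *)
Definition vsrows N (V : {vspace 'cV[R]_N}) : 'M[R]_(\dim V, N) :=
  \matrix_(i, j) tnth (vbasis V) i j 0.

Lemma row_vsrows N (V : {vspace 'cV[R]_N}) i :
  row i (vsrows V) = (tnth (vbasis V) i)^T.
Proof. by apply/rowP => j; rewrite !mxE. Qed.

Lemma sub_vsrows N (V : {vspace 'cV[R]_N}) (x : 'rV[R]_N) :
  (x <= vsrows V)%MS = (x^T \in V).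
Proof.
apply/idP/idP => [/submxP[c ->]|xV].
  have -> : (c *m vsrows V)^T = \sum_i c 0 i *: tnth (vbasis V) i.
    apply/colP => j; rewrite mxE mxE summxE; apply: eq_bigr => i _.
    by rewrite !mxE.
  by apply: memv_suml => i _; apply/memvZ/vbasis_mem/mem_tnth.
rewrite -[x]trmxK (coord_vbasis xV) linear_sum /= summx_sub // => i _.
by rewrite linearZ /= scalemx_sub // -tnth_nth -row_vsrows row_sub.
Qed.

Lemma vsrows_free N (V : {vspace 'cV[R]_N}) : row_free (vsrows V).
Proof.
apply: inj_row_free => c cV; apply/rowP => i; rewrite mxE.
have /freeP -> // := basis_free (vbasisP V).
apply/colP => j; have /rowP /(_ j) := cV; rewrite mxE [RHS]mxE => cVj.
rewrite summxE [RHS]mxE -[RHS]cVj.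
by apply: eq_bigr => k _; rewrite !mxE -tnth_nth.
Qed.

Lemma dotvE N (x y : 'cV[R]_N) : dotv x y = (x^T *m y) 0 0.
Proof. by rewrite mxE; apply: eq_bigr => i _; rewrite mxE. Qed.

Lemma form_onE N (B : 'M[R]_N) (V : {vspace 'cV[R]_N}) : B^T = B ->
  form_on B V = vsrows V *m B *m (vsrows V)^T.
Proof.
move=> symB; apply/matrixP => i j; rewrite !mxE dotvE trmx_mul symB.
rewrite -row_vsrows -[tnth _ j]trmxK -row_vsrows -row_mul mxE.
by apply: eq_bigr => k _; rewrite !mxE.
Qed.

Lemma morse_indexE N (B : 'M[R]_N) (V : {vspace 'cV[R]_N}) : B^T = B ->
  morse_index B V = ind B (vsrows V).
Proof. by move=> symB; rewrite /morse_index form_onE. Qed.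

Lemma memv_colker m N (A : 'M[R]_(m, N)) x : (x \in colker A) = (A *m x == 0).
Proof. by rewrite memv_ker lfunE. Qed.

Lemma eqmx_rows m1 m2 N (A : 'M[R]_(m1, N)) (B : 'M[R]_(m2, N)) :
  (forall x : 'rV_N, (x <= A)%MS = (x <= B)%MS) -> (A :=: B)%MS.
Proof.
move=> h; apply/eqmxP/andP; split; apply/row_subP => i.
  by rewrite -h row_sub.
by rewrite h row_sub.
Qed.

Lemma vsrows_colker m N (A : 'M[R]_(m, N)) :
  (vsrows (colker A) :=: kermx A^T)%MS.
Proof.
apply: eqmx_rows => x; rewrite sub_vsrows memv_colker; apply/eqP/sub_kermxP => h.
  by apply/trmx_inj; rewrite trmx_mul trmxK h trmx0.
by apply/trmx_inj; rewrite trmx_mul trmxK h trmx0.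
Qed.

Lemma dim_vsrows N (V : {vspace 'cV[R]_N}) : \dim V = \rank (vsrows V).
Proof. by have /eqP -> := vsrows_free V. Qed.

Lemma dim_colker m N (A : 'M[R]_(m, N)) : \dim (colker A) = (N - \rank A)%N.
Proof. by rewrite dim_vsrows vsrows_colker mxrank_ker mxrank_tr. Qed.

Lemma nullityE N (B : 'M[R]_N) (V : {vspace 'cV[R]_N}) : B^T = B ->
  nullity B V = (\dim V - \rank (vsrows V *m B *m (vsrows V)^T))%N.
Proof. by move=> symB; rewrite /nullity dim_colker form_onE. Qed.

Lemma complexify_exp n (A : 'M[R]_n) e :
  complexify A ^+ e = complexify (A ^+ e).
Proof.
elim: e => [|e IHe]; first by rewrite !expr0 /complexify map_mx1.
by rewrite !exprS IHe -![_ * _]/(_ *m _) /complexify map_mxM.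
Qed.

Variables (d : nat) (B : 'M[R]_(d + d)).
Hypothesis symB : B^T = B.

(** [J] is invertible, so [B] has the rank of [A]; for diagonalizable [A] this is the rank of a high
    power, whose range is symplectic. An odd rank therefore rules out linear stability. *)
Lemma linearly_stable_rank : linearly_stable B -> ~~ odd (\rank B).
Proof.
case=> _ diagB; set A := Jstd R d *m B in diagB *.
(* The exponent is [(d + d).+1], positive even for d = 0, as [rank_exp_diagonalizable] requires. *)
have := fitting_rank_even symB (leqnSn (d + d)).
rewrite -trmx_exp mxrank_tr -(mxrank_map (real_complex R)).
rewrite -/(complexify _) -complexify_exp rank_exp_diagonalizable //.
by rewrite mxrank_map eqmxMfull // row_full_unit Jstd_unit.
Qed.

(** A real eigenvalue of [A] is its own real part, so spectral stability forces it to be 0 and the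
    Fitting argument applies. *)
Lemma spectrally_stable_morse_index e : (d + d <= e)%N -> spectrally_stable B ->
  odd (neg_eigenvalues B) =
  odd (morse_index B (colker ((Jstd R d *m B) ^+ e))).
Proof.
move=> de ssB; rewrite morse_indexE // (ind_eqmx symB (vsrows_colker _)) trmx_exp.
apply: odd_neg_eigenvalues_fitting => // x.
rewrite eigenvalue_root_char -(fmorph_root (real_complex R)) map_char_poly.
by rewrite -eigenvalue_root_char => /ssB.
Qed.
End Bridge.

(** * The Hessian of the Newtonian potential *)

Section Derivatives.
Variable R : realType.
Local Open Scope classical_set_scope.

(** Passes to functions of one real variable, where the chain rule for the square root and
    polynomial derivatives can be used. *)
Lemma derive_line N (f : 'cV[R]_N -> R) (x v : 'cV[R]_N) :
  'D_v f x = 'D_1 (fun t : R => f (t *: v + x)) 0.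
Proof.
rewrite /derive; pose g (t : R) := f (t *: v + x).
suff -> : (fun h => h^-1 *: ((f \o shift x) (h *: v) - f x)) =
    (fun h : R => h^-1 *: ((g \o shift 0) (h *: (1 : R)) - g 0)) by [].
apply/funext => h; rewrite /g /=.
by rewrite addr0 scale0r add0r /GRing.scale /= mulr1.
Qed.

Lemma is_derive_bigsum (V : normedModType R) (x v : V) (I : Type) (r : seq I)
    (P : pred I) (f : I -> V -> R) (df : I -> R) :
  (forall i, P i -> is_derive x v (f i) (df i)) ->
  is_derive x v (fun y => \sum_(i <- r | P i) f i y) (\sum_(i <- r | P i) df i).
Proof.
move=> fdf; have -> : (fun y => \sum_(i <- r | P i) f i y) = \sum_(i <- r | P i) f i.
  by apply/funext => y; rewrite fct_sumE.
by elim/big_ind2: _ => // [|] *; [exact: is_derive_cst|exact: is_deriveD].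
Qed.

Lemma dotvC k (u v : 'cV[R]_k) : dotv u v = dotv v u.
Proof. by apply: eq_bigr => i _; rewrite mulrC. Qed.

Lemma dotvDl k (u v w : 'cV[R]_k) : dotv (u + v) w = dotv u w + dotv v w.
Proof. by rewrite -big_split; apply: eq_bigr => i _; rewrite mxE mulrDl. Qed.

Lemma dotvZl k a (u w : 'cV[R]_k) : dotv (a *: u) w = a * dotv u w.
Proof. by rewrite mulr_sumr; apply: eq_bigr => i _; rewrite mxE mulrA. Qed.

Lemma dotvDr k (u v w : 'cV[R]_k) : dotv w (u + v) = dotv w u + dotv w v.
Proof. by rewrite dotvC dotvDl !(dotvC w). Qed.

Lemma dotvZr k a (u w : 'cV[R]_k) : dotv w (a *: u) = a * dotv w u.
Proof. by rewrite dotvC dotvZl dotvC. Qed.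

Lemma dotv_gt0 k (u : 'cV[R]_k) : u != 0 -> 0 < dotv u u.
Proof.
move=> u0; rewrite dotvE -{2}[u]trmxK mxdot_gt0 //.
by apply: contra u0 => /eqP e; rewrite -[u]trmxK e trmx0.
Qed.

(** |t v + u|^2 as a polynomial in t. *)
Let normp k (u v : 'cV[R]_k) : {poly R} :=
  (dotv v v) *: 'X^2 + (2 * dotv u v) *: 'X + (dotv u u)%:P.

Lemma enorm_line k (u v : 'cV[R]_k) (t : R) :
  enorm (t *: v + u) = Num.sqrt (normp u v).[t].
Proof.
rewrite /enorm; congr Num.sqrt; rewrite /normp !hornerE.
by rewrite !(dotvDl, dotvDr, dotvZl, dotvZr) (dotvC v u) /=; ring.
Qed.

Lemma is_derive_enormV k (u v : 'cV[R]_k) : u != 0 ->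
  is_derive (0 : R) 1 (fun t : R => (enorm (t *: v + u))^-1)
    (- dotv u v * (enorm u)^-1 ^+ 3).
Proof.
move=> u0; have pu := dotv_gt0 u0.
have p0 : (normp u v).[0] = dotv u u by rewrite /normp !hornerE /=; ring.
have -> : (fun t : R => (enorm (t *: v + u))^-1) =
    (fun t : R => ((Num.sqrt \o (horner (normp u v))) t)^-1).
  by apply/funext => t; rewrite enorm_line.
have ds : is_derive (0 : R) 1 (Num.sqrt \o (horner (normp u v)))
    ((2 * Num.sqrt (normp u v).[0])^-1 * (deriv (normp u v)).[0]).
  by apply: is_derive1_comp; apply: is_derive1_sqrt; rewrite p0.
have s0 : (Num.sqrt \o (horner (normp u v))) 0 != 0.
  by rewrite /= p0 gt_eqF // sqrtr_gt0.
have [dd de] := is_deriveV s0 ds; apply: DeriveDef; first exact: dd.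
rewrite de /= p0 /normp !poly.derivE !hornerE /= /enorm.
have : Num.sqrt (dotv u u) != 0 by rewrite gt_eqF // sqrtr_gt0.
by move: (Num.sqrt _) => r r0; rewrite /GRing.scale /=; field.
Qed.

Lemma is_derive_dot_enormV k (u v w : 'cV[R]_k) : u != 0 ->
  is_derive (0 : R) 1
    (fun t : R => dotv (t *: v + u) w * (enorm (t *: v + u))^-1 ^+ 3)
    (dotv v w * (enorm u)^-1 ^+ 3
     - 3 * dotv u w * dotv u v * (enorm u)^-1 ^+ 5).
Proof.
move=> u0; pose l : {poly R} := dotv v w *: 'X + (dotv u w)%:P.
have -> : (fun t : R => dotv (t *: v + u) w * (enorm (t *: v + u))^-1 ^+ 3) =
    (horner l) * (fun t => (enorm (t *: v + u))^-1) ^+ 3.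
  apply/funext => t; rewrite /= !fctE dotvDl dotvZl; congr (_ * _).
  by rewrite /l !hornerE mulrC.
have [dd de] := is_deriveM (is_derive_poly l 0) (is_deriveX 3 (is_derive_enormV v u0)).
apply: DeriveDef; first exact: dd.
rewrite de /= !fctE scale0r add0r /l !poly.derivE !hornerE /= /GRing.scale /=; ring.
Qed.

Lemma near_line_neq0 k (u v : 'cV[R]_k) : u != 0 ->
  \forall t \near (0 : R), t *: v + u != 0.
Proof.
move=> u0; have /cV0Pn[i ui] : u != 0 by [].
pose p := v i 0 *: 'X + (u i 0)%:P.
have p0 : p.[0] = u i 0 by rewrite /p !hornerE /=; ring.
have : horner p x @[x --> (0 : R)] --> p.[0] by exact: continuous_horner.
rewrite p0 => /cvgr_neq0 /(_ ui); apply: filterS => t; apply: contraNneq.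
by move=> /colP /(_ i); rewrite /p !mxE !hornerE mulrC => ->.
Qed.
End Derivatives.

Section Hessian.
Variables (R : realType) (n : nat) (m : 'I_n -> R).
Implicit Types q v w : 'cV[R]_(n * 4).

Definition bodymx (j : 'I_n) : 'M[R]_(4, n * 4) :=
  rowsub (fun r => mxtens_index (j, r)) 1%:M.

Definition bodydiff (i j : 'I_n) : 'M[R]_(4, n * 4) := bodymx i - bodymx j.

Lemma bodymxE q j : bodymx j *m q = body q j.
Proof.
by rewrite mul_rowsub_mx mul1mx; apply/colP => r; rewrite !mxE.
Qed.

Lemma bodydiffE q i j : bodydiff i j *m q = body q i - body q j.
Proof. by rewrite mulmxBl !bodymxE. Qed.

Lemma bodymx_action j (a : 'M[R]_4) :
  bodymx j *m diagonal_action n a = a *m bodymx j.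
Proof.
rewrite mul_rowsub_mx mul1mx; apply/matrixP => r k.
have [j' s] := mxtens_indexP k; rewrite !mxE !mxtens_indexK /=.
rewrite (bigD1 s) //= big1 => [|t ts].
  by rewrite !mxE (inj_eq (can_inj (@mxtens_indexK _ _))) xpair_eqE eqxx andbT addr0 mulrC.
by rewrite !mxE (inj_eq (can_inj (@mxtens_indexK _ _))) xpair_eqE (negbTE ts) andbF mulr0.
Qed.

Lemma bodydiff_action i j (a : 'M[R]_4) :
  bodydiff i j *m diagonal_action n a = a *m bodydiff i j.
Proof. by rewrite mulmxBl !bodymx_action mulmxBr. Qed.

Lemma trmx_action (a : 'M[R]_4) :
  (diagonal_action n a)^T = diagonal_action n a^T.
Proof. by rewrite /diagonal_action trmx_tens trmx1. Qed.

Lemma bodydiff_actionT i j (a : 'M[R]_4) :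
  diagonal_action n a *m (bodydiff i j)^T = (bodydiff i j)^T *m a.
Proof.
by apply/trmx_inj; rewrite !trmx_mul trmxK trmx_action bodydiff_action.
Qed.

Definition collisionless q := forall i j, i != j -> body q i != body q j.

Definition invdist q i j : R := (enorm (bodydiff i j *m q))^-1.

Lemma collisionless_diff q (i j : 'I_n) : collisionless q -> (i < j)%N ->
  bodydiff i j *m q != 0.
Proof.
by move=> h ij; rewrite bodydiffE subr_eq0 h // neq_ltn ij.
Qed.

Lemma derive_potential q w : collisionless q ->
  'D_w (potential m) q = \sum_(i < n) \sum_(j < n | (i < j)%N)
    m i * m j * (- (dotv (bodydiff i j *m q) (bodydiff i j *m w) * invdist q i j ^+ 3)).
Proof.
move=> ncol; rewrite derive_line; apply: derive_val.
apply: is_derive_bigsum => i _; apply: is_derive_bigsum => j ij.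
have -> : (fun t : R => m i * m j / enorm (body (t *: w + q) i - body (t *: w + q) j))
    = (m i * m j) *: (fun t => (enorm (t *: (bodydiff i j *m w) + bodydiff i j *m q))^-1).
  by apply/funext => t; rewrite -bodydiffE mulmxDr -scalemxAr.
rewrite -mulNr; apply: is_deriveZ; apply: is_derive_enormV.
exact: collisionless_diff.
Qed.

(** The Hessian differentiates a gradient formula that is valid only off collisions; the formula
    must therefore hold for all small t, not just at t = 0. *)
Lemma near_collisionless q v : collisionless q ->
  \forall t \near (0 : R), collisionless (t *: v + q).
Proof.
move=> ncol.
have F0 : Filter (nbhs (0 : R)) by exact: nbhs_filter.
have h (i j : 'I_n) : \forall t \near (0 : R), i != j -> bodydiff i j *m (t *: v + q) != 0.
  have [->|ij] := eqVneq i j; first by apply: filterE => t; rewrite ?eqxx.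
  have := near_line_neq0 (bodydiff i j *m v) (_ : bodydiff i j *m q != 0).
  rewrite bodydiffE subr_eq0 ncol // => /(_ isT); apply: filterS => t.
  by rewrite -bodydiffE scalemxAr -mulmxDr.
have H : \forall t \near (0 : R), forall i j : 'I_n, i != j ->
    bodydiff i j *m (t *: v + q) != 0.
  have := filter_forall F0 (fun i => filter_forall F0 (h i)).
  exact.
apply: filterS H => t ht i j ij; move: (ht i j ij).
by rewrite bodydiffE subr_eq0.
Qed.

(** Each pair contributes 3 u u^T / |u|^5 - I / |u|^3, the Hessian of 1/|u| at u = q_i - q_j, pulled
    back by the difference map. *)
Definition hessmx q : 'M[R]_(n * 4) :=
  \sum_(i < n) \sum_(j < n | (i < j)%N) (m i * m j) *:
    ((bodydiff i j)^T *m
     ((3 * invdist q i j ^+ 5) *: (bodydiff i j *m q *m (bodydiff i j *m q)^T)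
      - (invdist q i j ^+ 3)%:M) *m bodydiff i j).

Lemma congr_entry k l (D : 'M[R]_(k, l)) (S : 'M[R]_k) (a b : 'I_l) :
  (D^T *m S *m D) a b = dotv (D *m delta_mx a 0) (S *m (D *m delta_mx b 0)).
Proof.
rewrite dotvE trmx_mul trmx_delta !mulmxA -rowE -colE [RHS]mxE.
by rewrite -!row_mul [RHS]mxE.
Qed.

Lemma dotv_rank1 k (c s : R) (u x y : 'cV[R]_k) :
  dotv x ((c *: (u *m u^T) - s%:M) *m y) = c * dotv u x * dotv u y - s * dotv x y.
Proof.
rewrite mulmxBl -scalemxAl -mulmxA [u^T *m y]mx11_scalar -dotvE mul_mx_scalar.
rewrite mul_scalar_mx -scaleNr dotvDr !dotvZr (dotvC x u); ring.
Qed.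

Lemma hessianE q : collisionless q -> hessian (potential m) q = hessmx q.
Proof.
move=> ncol; apply/matrixP => a b; rewrite mxE derive_line.
set ea := delta_mx a 0; set eb := delta_mx b 0.
rewrite (near_eq_derive (g := fun t : R => \sum_(i < n) \sum_(j < n | (i < j)%N)
  m i * m j * (- (dotv (t *: (bodydiff i j *m ea) + bodydiff i j *m q) (bodydiff i j *m eb)
   * (enorm (t *: (bodydiff i j *m ea) + bodydiff i j *m q))^-1 ^+ 3)))); last first.
  have := near_collisionless ea ncol; apply: filterS => t /derive_potential ->.
  apply: eq_bigr => i _; apply: eq_bigr => j _; rewrite /invdist.
  by rewrite mulmxDr -scalemxAr.
have -> : hessmx q a b = \sum_(i < n) \sum_(j < n | (i < j)%N) m i * m j *
   (- (dotv (bodydiff i j *m ea) (bodydiff i j *m eb) * (invdist q i j) ^+ 3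
     - 3 * dotv (bodydiff i j *m q) (bodydiff i j *m eb)
        * dotv (bodydiff i j *m q) (bodydiff i j *m ea) * (invdist q i j) ^+ 5)).
  rewrite /hessmx summxE; apply: eq_bigr => i _; rewrite summxE.
  apply: eq_bigr => j _; rewrite mxE; congr (_ * _).
  by rewrite congr_entry dotv_rank1; ring.
apply: derive_val.
apply: is_derive_bigsum => i _; apply: is_derive_bigsum => j ij.
pose g := (fun t : R => dotv (t *: (bodydiff i j *m ea) + bodydiff i j *m q) (bodydiff i j *m eb)
   * (enorm (t *: (bodydiff i j *m ea) + bodydiff i j *m q))^-1 ^+ 3).
have -> : (fun t : R => m i * m j * - g t) = (m i * m j) *: - g by [].
apply: is_deriveZ; apply: is_deriveN; apply: is_derive_dot_enormV.
exact: collisionless_diff.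
Qed.
End Hessian.

Section HessianFacts.
Variables (R : realType) (n : nat) (m : 'I_n -> R).
Implicit Types q v w : 'cV[R]_(n * 4).

Lemma hessmx_sym q : (hessmx m q)^T = hessmx m q.
Proof.
rewrite /hessmx linear_sum /=; apply: eq_bigr => i _.
rewrite linear_sum /=; apply: eq_bigr => j _.
rewrite linearZ /=; congr (_ *: _); rewrite !trmx_mul trmxK mulmxA.
congr (_ *m _ *m _); rewrite linearB /= linearZ /= tr_scalar_mx.
by rewrite !trmx_mul !trmxK.
Qed.

Lemma gradientE q : collisionless q -> gradient (potential m) q =
  \sum_(i < n) \sum_(j < n | (i < j)%N)
    - (m i * m j * invdist q i j ^+ 3) *: ((bodydiff R i j)^T *m (bodydiff R i j *m q)).
Proof.
move=> ncol; apply/colP => a; rewrite mxE derive_potential // summxE.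
apply: eq_bigr => i _; rewrite summxE; apply: eq_bigr => j _.
rewrite mxE dotvC dotvE trmx_mul trmx_delta -mulmxA -rowE mxE; ring.
Qed.

Lemma antisym_form_eq0 k (a : 'M[R]_k) (u : 'cV[R]_k) : a^T = - a ->
  u^T *m a *m u = 0.
Proof.
move=> aa; rewrite [LHS]mx11_scalar; set s := _ 0 0.
suff -> : s = 0 by rewrite raddf0.
have : (u^T *m a *m u)^T = - (u^T *m a *m u).
  by rewrite !trmx_mul trmxK aa mulNmx mulmxN mulmxA.
by move=> /matrixP /(_ 0 0); rewrite mxE [RHS]mxE -/s => /eqP; lra.
Qed.

(** Infinitesimal rotation equivariance of the gradient. In the computation u^T a u = 0 kills the
    rank-one term of each pair. *)
Lemma hessmx_antisym q (a : 'M[R]_4) : collisionless q -> a^T = - a ->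
  hessmx m q *m (diagonal_action n a *m q) =
  diagonal_action n a *m gradient (potential m) q.
Proof.
move=> ncol aa; rewrite gradientE // /hessmx mulmx_suml mulmx_sumr.
apply: eq_bigr => i _; rewrite mulmx_suml mulmx_sumr; apply: eq_bigr => j _.
rewrite -scalemxAl -scalemxAr (mulmxA (diagonal_action n a)) bodydiff_actionT.
move: (bodydiff R i j) (@bodydiff_action R n i j a) => D Da.
set u := D *m q; set S := (_ - _).
have -> : D^T *m S *m D *m (diagonal_action n a *m q) = D^T *m (S *m (a *m u)).
  by rewrite /u !mulmxA -(mulmxA _ D) Da !mulmxA.
have -> : S *m (a *m u) = - invdist q i j ^+ 3 *: (a *m u).
  rewrite /S mulmxBl -scalemxAl -(mulmxA u) (mulmxA u^T) antisym_form_eq0 //.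
  by rewrite mulmx0 scaler0 add0r mul_scalar_mx scaleNr.
by rewrite -scalemxAr scalerA mulrN mulmxA.
Qed.

(** When [a] and [a^T] annihilate all bodies, both products of [a] with u u^T vanish, so [a]
    commutes with every pair term. Applied to matrices acting on the directions normal to a planar
    [q]. *)
Lemma hessmx_action q (a : 'M[R]_4) : (forall j, a *m body q j = 0) ->
  (forall j, a^T *m body q j = 0) ->
  hessmx m q *m diagonal_action n a = diagonal_action n a *m hessmx m q.
Proof.
move=> aq atq; rewrite /hessmx mulmx_suml mulmx_sumr.
apply: eq_bigr => i _; rewrite mulmx_suml mulmx_sumr; apply: eq_bigr => j _.
rewrite -scalemxAl -scalemxAr; congr (_ *: _).
set S := (_ - _); have aS : S *m a = a *m S.
  have au : a *m (bodydiff R i j *m q) = 0 by rewrite bodydiffE mulmxBr !aq subr0.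
  have atu : (bodydiff R i j *m q)^T *m a = 0.
    apply/trmx_inj; rewrite [LHS]trmx_mul trmxK trmx0 bodydiffE mulmxBr !atq.
    by rewrite subr0.
  rewrite /S mulmxBl mulmxBr -scalemxAl -scalemxAr mulmxA au mul0mx.
  by rewrite -(mulmxA _ _ a) atu mulmx0 scalar_mxC.
rewrite -(mulmxA _ (bodydiff R i j)) bodydiff_action mulmxA -(mulmxA _ S) aS.
by rewrite !mulmxA bodydiff_actionT.
Qed.

Lemma massmxE : massmx m = diag_mx (\row_k m (mxtens_unindex k).1).
Proof.
apply/matrixP => k l; have [i r] := mxtens_indexP k; have [j s] := mxtens_indexP l.
rewrite tensmxE !mxE mxtens_indexK /= (inj_eq (can_inj (@mxtens_indexK _ _))).
by rewrite xpair_eqE; case: eqP => _; rewrite ?mul0r //= mulr_natr.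
Qed.

Lemma massmx_sym : (massmx m)^T = massmx m.
Proof. by rewrite massmxE tr_diag_mx. Qed.

Lemma massmx_action a : massmx m *m diagonal_action n a = diagonal_action n a *m massmx m.
Proof. by rewrite /massmx /diagonal_action !tensmx_mul !mulmx1 !mul1mx. Qed.

Hypothesis m_gt0 : forall i, 0 < m i.

Lemma massmx_posdef (x : 'rV[R]_(n * 4)) : x != 0 -> 0 < (x *m massmx m *m x^T) 0 0.
Proof.
move=> /rV0Pn[j xj]; rewrite massmxE diag_form (bigD1 j) //= ltr_pwDl //.
  by rewrite mxE mulr_gt0 // exprn_even_gt0.
by apply: sumr_ge0 => i _; rewrite mxE mulr_ge0 ?sqr_ge0 // ltW.
Qed.

Lemma massmx_unit : massmx m \in unitmx.
Proof.
rewrite massmxE unitmxE det_diag unitfE; apply/prodf_neq0 => i _.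
by rewrite mxE gt_eqF.
Qed.

Lemma potential_ge0 q : 0 <= potential m q.
Proof.
apply: sumr_ge0 => i _; apply: sumr_ge0 => j _.
by rewrite divr_ge0 ?sqrtr_ge0 // mulr_ge0 // ltW.
Qed.

(** The left side equals a (grad U + U M q), which is zero by criticality. *)
Lemma cc_hessian_antisym q (a : 'M[R]_4) : central_configuration m q -> a^T = - a ->
  hess_form m q *m (diagonal_action n a *m q) = 0.
Proof.
case=> ncol _ _ /eqP; rewrite addr_eq0 => /eqP crit aa.
rewrite /hess_form hessianE // mulmxDl hessmx_antisym // crit mulmxN.
by rewrite -scalemxAr -scalemxAl !mulmxA massmx_action addNr.
Qed.
End HessianFacts.

(** * Orthogonality and rank for a positive definite form *)

Section PositiveDefinite.
Variables (R : realType) (N : nat) (M : 'M[R]_N).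
Hypothesis M_sym : M^T = M.
Hypothesis M_gt0 : forall x : 'rV[R]_N, x != 0 -> 0 < (x *m M *m x^T) 0 0.

Lemma posdef_eq0 k (W : 'M[R]_(k, N)) : W *m M *m W^T = 0 -> W = 0.
Proof.
move=> W0; apply/row_matrixP => i; rewrite row0; apply/eqP/contraT => /M_gt0.
have -> : (row i W *m M *m (row i W)^T) 0 0 = (W *m M *m W^T) i i.
  rewrite -row_mul mxE [RHS]mxE; apply: eq_bigr => l _.
  by congr (_ * _); rewrite ?mxE.
by rewrite W0 mxE ltxx.
Qed.

(** The intersection of two orthogonal row spaces is orthogonal to itself, hence zero. *)
Lemma posdef_disjoint k1 k2 (W1 : 'M[R]_(k1, N)) (W2 : 'M[R]_(k2, N)) :
  W1 *m M *m W2^T = 0 -> \rank (W1 + W2)%MS = (\rank W1 + \rank W2)%N.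
Proof.
move=> W12; apply: mxrank_disjoint_sum; apply: posdef_eq0.
have /submxP[C1 e1] := capmxSl W1 W2; have /submxP[C2 e2] := capmxSr W1 W2.
by rewrite {1}e1 e2 trmx_mul !mulmxA -(mulmxA C1) -(mulmxA C1) W12 mulmx0 mul0mx.
Qed.

Lemma posdef_rank k (W : 'M[R]_(k, N)) : \rank (W *m M *m W^T) = \rank W.
Proof.
apply/eqP; rewrite eqn_leq -mulmxA mxrankM_maxl /= mulmxA.
have : (kermx (W *m M *m W^T) <= kermx W)%MS.
  apply/sub_kermxP/posdef_eq0; rewrite trmx_mul !mulmxA.
  have := mulmx_ker (W *m M *m W^T); rewrite !mulmxA => ->.
  by rewrite mul0mx.
by move=> /mxrankS; rewrite !mxrank_ker; have := rank_leq_row W; lia.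
Qed.

Lemma posdef_ind k (W : 'M[R]_(k, N)) : ind M W = 0%N.
Proof.
apply: neg_eigenvalues_posdef => [|x]; first by rewrite trmx_congr.
rewrite !mulmxA -(mulmxA (x *m W *m M)) -trmx_mul.
have [->|/M_gt0/ltW //] := eqVneq (x *m W) 0.
by rewrite !mul0mx mxE.
Qed.

End PositiveDefinite.

(** * Reduction to configuration space *)

Section SymplecticReduction.
Variables (R : realType) (N : nat) (M D K : 'M[R]_N).
Hypothesis M_sym : M^T = M.
Hypothesis M_gt0 : forall x : 'rV[R]_N, x != 0 -> 0 < (x *m M *m x^T) 0 0.
Hypothesis M_unit : M \in unitmx.
Hypothesis D_sym : D^T = D.
Hypothesis K_anti : K^T = - K.

Variables (k : nat) (Z : 'M[R]_(k, N)).
Hypothesis ZK : (Z *m K <= Z)%MS.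

Let L := block_mx K (invmx M) D K.
Let B := Jstd R N *m L.
Let G := D - K *m M *m K.

Lemma hamiltonian_block : B = block_mx (- D) (- K) K (invmx M).
Proof.
rewrite /B /Jstd mulmx_block !(mul0mx, add0r, addr0, mul1mx).
by rewrite !mulNmx !mul1mx.
Qed.

Lemma hamiltonian_sym : B^T = B.
Proof.
rewrite hamiltonian_block tr_block_mx !linearN /= D_sym K_anti opprK.
by rewrite trmx_inv M_sym.
Qed.

Lemma reduced_form_sym : G^T = G.
Proof.
rewrite /G linearB /= D_sym !trmx_mul M_sym K_anti mulNmx mulmxN mulmxN opprK.
by rewrite mulmxA.
Qed.

Variables (d : nat) (S : 'M[R]_(N + N, d + d)) (L3 : 'M[R]_(d + d)).
Hypothesis S_symp : S^T *m Jstd R N *m S = Jstd R d.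
Hypothesis S_rows : (S^T :=: block_mx Z 0 0 (Z *m M))%MS.
Hypothesis LS : L *m S = S *m L3.

Let B3 := Jstd R d *m L3.

(** The symplectic basis turns J L3 = S^T J S L3 into S^T J L S, so [B3] is the Gram matrix of [B]
    on E3. *)
Lemma B3_congr : B3 = S^T *m B *m (S^T)^T.
Proof. by rewrite trmxK /B3 -S_symp -!mulmxA -LS /B !mulmxA. Qed.

Lemma B3_sym : B3^T = B3.
Proof. by rewrite B3_congr trmx_congr // hamiltonian_sym. Qed.

(** Basis of E3 sheared to complete the square: the rows (z, z K M) are the column vectors (x, - M K
    x). Invariance of Z under K keeps the span unchanged. *)
Let W := block_mx Z (Z *m K *m M) 0 (Z *m M).

Lemma W_rows : (S^T :=: W)%MS.
Proof.
apply: (eqmx_trans S_rows); have /submxP[C eC] := ZK.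
apply/eqmxP/andP; split; apply/submxP.
  exists (block_mx 1%:M (- C) 0 1%:M).
  rewrite mulmx_block !(mul0mx, mulmx0, add0r, addr0, mul1mx) eC.
  by rewrite mulNmx mulmxA subrr.
exists (block_mx 1%:M C 0 1%:M).
by rewrite mulmx_block !(mul0mx, mulmx0, add0r, addr0, mul1mx) /W eC mulmxA.
Qed.

Lemma W_form : W *m B *m W^T = block_mx (- (Z *m G *m Z^T)) 0 0 (Z *m M *m Z^T).
Proof.
rewrite hamiltonian_block /W tr_block_mx !mulmx_block.
rewrite !(mul0mx, mulmx0, add0r, addr0, trmx0) !(mulmxK M_unit) !mulmxN addNr.
rewrite !(mul0mx, mulmx0, add0r, addr0) !trmx_mul M_sym K_anti.
congr block_mx.
- by rewrite -[RHS]mulNmx; congr (_ *m _); rewrite /G mulmxBr opprB addrC !mulmxA.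
- by rewrite mulNmx !mulmxN !mulmxA subrr.
- by rewrite !mulmxA.
Qed.

Lemma neg_B3 : neg_eigenvalues B3 = ind (- G) Z.
Proof.
rewrite B3_congr -/(ind B S^T) (ind_eqmx hamiltonian_sym W_rows) /ind W_form.
have GZ := trmx_congr Z reduced_form_sym; have MZ := trmx_congr Z M_sym.
have GZN : (- (Z *m G *m Z^T))^T = - (Z *m G *m Z^T).
  by rewrite [LHS]linearN /= GZ.
rewrite (neg_eigenvalues_block GZN MZ) -/(ind M Z) posdef_ind // addn0.
by rewrite /ind mulmxN mulNmx.
Qed.

Lemma rank_B3 : \rank B3 = (\rank (Z *m G *m Z^T) + \rank Z)%N.
Proof.
have symB := hamiltonian_sym; have symNB : (- B)^T = - B by rewrite linearN /= symB.
have -> : \rank B3 = \rank (W *m B *m W^T).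
  rewrite B3_congr !rank_ind //.
  by rewrite (ind_eqmx symB W_rows) (ind_eqmx symNB W_rows).
by rewrite W_form rank_diag_block_mx mxrank_opp (posdef_rank M_gt0).
Qed.

Lemma dim_B3 : (d + d = \rank Z + \rank Z)%N.
Proof.
have frS : row_free S^T.
  apply: inj_row_free => c cS; have := mulmxK (Jstd_unit R d) c.
  by rewrite -S_symp !mulmxA cS !mul0mx.
move: frS => /eqP <-; rewrite S_rows rank_diag_block_mx; congr (_ + _)%N.
by rewrite mxrankMfree // row_free_unit.
Qed.
End SymplecticReduction.

(** * Row descriptions of spans, sums and symplectic complements *)

Section RowSpaces.
Variable R : realType.

Lemma mx_entry k l (A : 'M[R]_(k, l)) i j :
  A i j = ((delta_mx i 0 : 'cV_k)^T *m A *m (delta_mx j 0 : 'cV_l)) 0 0.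
Proof. by rewrite trmx_delta -rowE -colE !mxE. Qed.

Lemma vsrows_eqmx k N (V : {vspace 'cV[R]_N}) (A : 'M[R]_(k, N)) :
  (forall x : 'rV[R]_N, (x <= A)%MS = (x^T \in V)) -> (vsrows V :=: A)%MS.
Proof. by move=> h; apply: eqmx_rows => x; rewrite sub_vsrows h. Qed.

Lemma vsrows_colspan m N (A : 'M[R]_(N, m)) : (vsrows (colspan A) :=: A^T)%MS.
Proof.
apply: vsrows_eqmx => x; apply/idP/idP => [/submxP[c ->]|/memv_imgP[c _]].
  by rewrite trmx_mul trmxK; apply/memv_imgP; exists c^T; rewrite ?memvf // lfunE.
by rewrite lfunE /= => e; rewrite -[x]trmxK e trmx_mul submxMl.
Qed.

Lemma vsrows_add N (U V : {vspace 'cV[R]_N}) :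
  (vsrows (U + V)%VS :=: vsrows U + vsrows V)%MS.
Proof.
apply: vsrows_eqmx => x; apply/sub_addsmxP/memv_addP => [[[c1 c2] /= e]|[u uU [v vV e]]].
  have h1 : (c1 *m vsrows U)^T \in U by rewrite -sub_vsrows submxMl.
  have h2 : (c2 *m vsrows V)^T \in V by rewrite -sub_vsrows submxMl.
  exists (c1 *m vsrows U)^T => //; exists (c2 *m vsrows V)^T => //.
  by rewrite e linearD.
have /submxP[c1 e1] : (u^T <= vsrows U)%MS by rewrite sub_vsrows trmxK.
have /submxP[c2 e2] : (v^T <= vsrows V)%MS by rewrite sub_vsrows trmxK.
by exists (c1, c2); rewrite /= -e1 -e2 -linearD /= -e trmxK.
Qed.

Lemma vsrows_span N (I : Type) (s : seq I) (x0 : I) (f : I -> 'cV[R]_N) :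
  (vsrows <<[seq f a | a <- s]>>%VS :=: \matrix_(i < size s) (f (nth x0 s i))^T)%MS.
Proof.
apply: vsrows_eqmx => x; set X := map f s.
have sz : size X = size s by rewrite size_map.
have nX i : (i < size s)%N -> X`_i = f (nth x0 s i) by move=> h; rewrite (nth_map x0).
apply/idP/idP => [/submxP[c ->]|xX].
  rewrite mulmx_sum_row linear_sum; apply: memv_suml => i _.
  rewrite linearZ /= rowK trmxK memvZ // -nX // memv_span // mem_nth ?sz //.
rewrite -[x]trmxK (coord_span (X := in_tuple X) xX) linear_sum summx_sub // => i _.
rewrite linearZ /= scalemx_sub //.
have hi : (i < size s)%N by rewrite -sz.
rewrite nX //; set A := \matrix_(_ < _) _.
have <- : row (Ordinal hi) A = (f (nth x0 s i))^T by rewrite rowK.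
exact: row_sub.
Qed.

Lemma vsrows_omega_orth N (E : {vspace 'cV[R]_(N + N)}) :
  (vsrows (omega_orth E) :=: kermx (Jstd R N *m (vsrows E)^T))%MS.
Proof.
apply: vsrows_eqmx => x; rewrite /omega_orth.
have -> : (x^T \in (\bigcap_(y <- vbasis E) colker ((Jstd R N *m y)^T))%VS) =
   all (fun y => (Jstd R N *m y)^T *m x^T == 0) (vbasis E).
  elim: (vbasis E : seq _) => [|y s IHs]; first by rewrite big_nil memvf.
  by rewrite big_cons memv_cap IHs memv_colker.
apply/sub_kermxP/allP => [h y yE|h].
  have /submxP[c ec] : (y^T <= vsrows E)%MS by rewrite sub_vsrows trmxK vbasis_mem.
  apply/eqP/trmx_inj; rewrite trmx_mul !trmxK trmx0 -[y]trmxK ec trmx_mul.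
  by rewrite !mulmxA -(mulmxA x) h mul0mx.
apply/trmx_inj; rewrite trmx0; apply/row_matrixP => i; rewrite row0.
have -> : (x *m (Jstd R N *m (vsrows E)^T))^T =
    vsrows E *m ((Jstd R N)^T *m x^T) by rewrite !trmx_mul trmxK mulmxA.
by rewrite row_mul row_vsrows mulmxA -trmx_mul; apply/eqP/h/mem_tnth.
Qed.
End RowSpaces.

Section SymplecticBasis.
Variables (R : realType) (N k : nat) (M : 'M[R]_N) (X : 'M[R]_(k, N)).
Hypothesis M_sym : M^T = M.
Hypothesis M_unit : M \in unitmx.
Let Z := kermx (M *m X^T).

(** The symplectic form pairs positions with momenta, so the complement of X x MX is a product:
    positions lie in Z, and momenta, divided by the invertible [M], lie in Z as well. *)
Lemma symplectic_rows (d : nat) (E : {vspace 'cV[R]_(N + N)})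
    (S : 'M[R]_(N + N, d + d)) :
  (vsrows E :=: block_mx X 0 0 (X *m M))%MS -> symplectic_basis S (omega_orth E) ->
  S^T *m Jstd R N *m S = Jstd R d /\ (S^T :=: block_mx Z 0 0 (Z *m M))%MS.
Proof.
move=> eE [cS omS]; split.
  have entry p (Y : 'M[R]_(N + N, p)) (i j : 'I_p) :
      omega0 (col i Y) (col j Y) = - (Y^T *m Jstd R N *m Y) i j.
    rewrite (mx_entry _ i j) /omega0 dotvE !colE !trmx_mul Jstd_tr.
    by rewrite mulmxN mulNmx mxE !mulmxA.
  apply/matrixP => i j; apply/oppr_inj; rewrite -entry omS /omega0 dotvE.
  by rewrite (mx_entry _ i j) trmx_mul Jstd_tr mulmxN mulNmx mxE.
apply: (eqmx_trans (eqmx_sym (vsrows_colspan S))); rewrite cS.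
apply: (eqmx_trans (vsrows_omega_orth E)).
apply: eqmx_rows => x; set P := block_mx X 0 0 (X *m M) in eE *.
have -> : (x <= kermx (Jstd R N *m (vsrows E)^T))%MS = (x *m Jstd R N *m P^T == 0).
  apply/sub_kermxP/eqP => h.
    have /submxP[C ->] : (P <= vsrows E)%MS by rewrite eE.
    by rewrite trmx_mul mulmxA -(mulmxA x) h mul0mx.
  have /submxP[C ->] : (vsrows E <= P)%MS by rewrite eE.
  by rewrite trmx_mul !mulmxA h mul0mx.
rewrite -[x]hsubmxK; set y := lsubmx x; set w := rsubmx x.
have -> : row_mx y w *m Jstd R N *m P^T = row_mx (w *m X^T) (- (y *m M *m X^T)).
  rewrite /Jstd mul_row_block /P tr_block_mx mul_row_block trmx_mul M_sym.
  rewrite !(mulmx0, mul0mx, trmx0, add0r, addr0, mulmx1, mulmxN, mulNmx, subr0).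
  by rewrite !mulmxA.
rewrite -row_mx0; apply/eqP/submxP => [/eq_row_mx[wX yX]|[C eC]].
  have /submxP[C1 e1] : (y <= Z)%MS.
    by apply/sub_kermxP; rewrite mulmxA -[LHS]opprK yX oppr0.
  have /submxP[C2 e2] : (w *m invmx M <= Z)%MS.
    by apply/sub_kermxP; rewrite !mulmxA mulmxKV.
  exists (row_mx C1 C2); rewrite mul_row_block !mulmx0 addr0 add0r -e1.
  by rewrite mulmxA -e2 mulmxKV.
move: eC; rewrite -[C]hsubmxK mul_row_block !mulmx0 addr0 add0r => /eq_row_mx[-> ->].
have ZX : Z *m M *m X^T = 0 by rewrite -mulmxA mulmx_ker.
by rewrite -(mulmxA (rsubmx C)) ZX -(mulmxA (lsubmx C) Z) -(mulmxA (lsubmx C)) ZX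
  !mulmx0 oppr0.
Qed.
End SymplecticBasis.

(** * Infinitesimal rotations of a configuration *)

Section OrbitRank.
Variable R : realType.

Definition all_pairs : seq (nat * nat) := rcons planar_pairs (3, 4)%N.

Definition pair_nth (p : 'I_6) := nth (0, 0)%N all_pairs p.

Definition antisym_of (c : 'rV[R]_6) : 'M[R]_4 :=
  \sum_p c 0 p *: Krot R (pair_nth p).1 (pair_nth p).2.

(** Reads the entry (r, l), where [Krot l r] has its +1; the predecessors convert positions numbered
    from 1 into indices from 0. *)
Definition antisym_coord (A : 'M[R]_4) : 'rV[R]_6 :=
  \row_p A (inord (pair_nth p).2.-1) (inord (pair_nth p).1.-1).

Lemma Krot_antisym l r : (Krot R l r)^T = - Krot R l r.
Proof. by apply/matrixP => a b; rewrite !mxE opprB ![(b.+1 == _) && _]andbC. Qed.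

Lemma antisym_of_antisym c : (antisym_of c)^T = - antisym_of c.
Proof.
rewrite /antisym_of linear_sum -sumrN; apply: eq_bigr => p _.
by rewrite linearZ /= Krot_antisym scalerN.
Qed.

Lemma antisym_ofK : cancel antisym_of antisym_coord.
Proof.
move=> c; apply/rowP => p; rewrite mxE /antisym_of summxE.
rewrite 6!big_ord_recl big_ord0 !mxE.
case: p => -[|[|[|[|[|[|//]]]]]] h; rewrite ?inordK //=;
  rewrite !(subrr, subr0, mulr0, mulr1, addr0, add0r); congr (c _ _); exact: val_inj.
Qed.

Lemma antisym_coordK A : A^T = - A -> antisym_of (antisym_coord A) = A.
Proof.
move=> /matrixP aA; have e i j : A j i = - A i j by have := aA i j; rewrite !mxE.
have e0 i : A i i = 0 by have := e i i; lra.
apply/matrixP => i j; rewrite -[i in RHS]inord_val -[j in RHS]inord_val.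
rewrite /antisym_of summxE 6!big_ord_recl big_ord0 !mxE.
case: i j => -[|[|[|[|//]]]] hi [[|[|[|[|//]]]] hj] /=;
  rewrite !(subrr, sub0r, subr0, mulr0, mulrN1, mulr1, addr0, add0r) ?e0 //;
  by rewrite [RHS]e.
Qed.

Lemma pair_nth_lt p : ((pair_nth p).1 < (pair_nth p).2 <= 4)%N.
Proof. by case: p => -[|[|[|[|[|[|//]]]]]]. Qed.

Lemma pair_nth_gt0 p : (0 < (pair_nth p).1)%N.
Proof. by case: p => -[|[|[|[|[|[|//]]]]]]. Qed.

Lemma pid_mx_mul_entry k l (A : 'M[R]_(k, l)) r i j :
  ((pid_mx r : 'M[R]_k) *m A) i j = (i < r)%:R * A i j.
Proof.
rewrite mxE (bigD1 i) //= big1 ?addr0 ?mxE ?eqxx // => i' li.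
have il : (i == i' :> nat) = false by rewrite eq_sym; apply/negbTE.
by rewrite mxE il mul0r.
Qed.

(** The generator of a pair l < s meets the first r rows exactly when l <= r, and distinct pairs
    occupy distinct entries. *)
Lemma antisym_of_top c r : (pid_mx r *m antisym_of c == 0 :> 'M[R]_4) =
  [forall p : 'I_6, ((pair_nth p).1 <= r)%N ==> (c 0 p == 0)].
Proof.
apply/eqP/forallP => [h p|h].
  apply/implyP => lp.
  have -> : c 0 p = antisym_coord (antisym_of c) 0 p by rewrite antisym_ofK.
  rewrite mxE.
  set i := inord _; set j := inord _.
  have -> : antisym_of c i j = - antisym_of c j i.
    by have /matrixP /(_ j i) := antisym_of_antisym c; rewrite !mxE.
  rewrite oppr_eq0; have /matrixP /(_ j i) := h.
  have /andP[lt_p le_p] := pair_nth_lt p; have gt_p := pair_nth_gt0 p.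
  rewrite pid_mx_mul_entry mxE /j inordK; last by lia.
  by rewrite prednK // lp mul1r => ->.
apply/matrixP => i j; rewrite [RHS]mxE pid_mx_mul_entry.
have [ir|_] := ltnP i r; last by rewrite mul0r.
rewrite mul1r /antisym_of summxE big1 // => p _; rewrite mxE.
have [lp|lp] := leqP (pair_nth p).1 r.
  by have /implyP /(_ lp) /eqP -> := h p; rewrite mul0r.
have /andP[lt_p le_p] := pair_nth_lt p.
have i1 : (i.+1 == (pair_nth p).1) = false by apply/negbTE/eqP; lia.
have i2 : (i.+1 == (pair_nth p).2) = false by apply/negbTE/eqP; lia.
by rewrite mxE i1 i2 subrr mulr0.
Qed.

Lemma eq_rank_ker k N1 N2 (A : 'M[R]_(k, N1)) (B : 'M[R]_(k, N2)) :
  (forall c : 'rV[R]_k, c *m A = 0 <-> c *m B = 0) -> \rank A = \rank B.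
Proof.
move=> h; have e : (kermx A :=: kermx B)%MS.
  by apply: eqmx_rows => c; apply/sub_kermxP/sub_kermxP => /h.
have := congr1 (subn k) (mxrank_ker A); rewrite e mxrank_ker.
by have := rank_leq_row A; have := rank_leq_row B; lia.
Qed.

Section Frame.
Variable U : 'M[R]_4.
Hypothesis U_unit : U \in unitmx.

Definition antisym_congr : 'M[R]_6 :=
  \matrix_(p, k) antisym_coord
    (U *m Krot R (pair_nth p).1 (pair_nth p).2 *m U^T) 0 k.

Lemma mul_antisym_congr c :
  antisym_of (c *m antisym_congr) = U *m antisym_of c *m U^T.
Proof.
have -> : c *m antisym_congr = antisym_coord (U *m antisym_of c *m U^T).
  apply/rowP => k; rewrite mxE [RHS]mxE /antisym_of mulmx_sumr mulmx_suml summxE.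
  apply: eq_bigr => p _; rewrite -scalemxAr -scalemxAl [RHS]mxE; congr (_ * _).
  by rewrite mxE [LHS]mxE.
apply: antisym_coordK.
by rewrite !trmx_mul trmxK antisym_of_antisym mulNmx mulmxN mulmxA.
Qed.

Lemma antisym_congr_free : row_free antisym_congr.
Proof.
apply: inj_row_free => c c0; have := mul_antisym_congr c.
rewrite c0 => e.
have a0 : antisym_of c = 0.
  have Ut : U^T \in unitmx by rewrite unitmx_tr.
  rewrite -[antisym_of c](mulKmx U_unit) -[U *m _](mulmxK Ut) -e.
  rewrite (_ : antisym_of 0 = 0) ?mul0mx ?mulmx0 // /antisym_of big1 // => p _.
  by rewrite mxE scale0r.
by rewrite -[c]antisym_ofK a0; apply/rowP => p; rewrite !mxE.
Qed.
End Frame.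

Variable n : nat.
Implicit Types q : 'cV[R]_(n * 4).

Definition config q : 'M[R]_(n, 4) := \matrix_j (body q j)^T.

Lemma body_action (a : 'M[R]_4) q j : body (diagonal_action n a *m q) j = a *m body q j.
Proof. by rewrite -!bodymxE mulmxA bodymx_action mulmxA. Qed.

Lemma config_eq0 q : config q = 0 -> q = 0.
Proof.
move=> h; apply/colP => k; have [j r] := mxtens_indexP k.
by have /matrixP /(_ j r) := h; rewrite !mxE.
Qed.

Lemma config_action (a : 'M[R]_4) q : config (diagonal_action n a *m q) = config q *m a^T.
Proof.
by apply/row_matrixP => j; rewrite row_mul !rowK body_action trmx_mul.
Qed.

Lemma action_eq0 (a : 'M[R]_4) q :
  diagonal_action n a *m q = 0 <-> config q *m a^T = 0.
Proof.
rewrite -config_action; split=> [->|/config_eq0 //].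
by apply/matrixP => i j; rewrite !mxE.
Qed.

Definition orbit_rows q : 'M[R]_(6, n * 4) :=
  \matrix_p (diagonal_action n (Krot R (pair_nth p).1 (pair_nth p).2) *m q)^T.

Lemma diagonal_actionD (a b : 'M[R]_4) :
  diagonal_action n (a + b) = diagonal_action n a + diagonal_action n b.
Proof.
apply/matrixP => k l; have [i r] := mxtens_indexP k; have [j s] := mxtens_indexP l.
by rewrite /diagonal_action [RHS]mxE !tensmxE [X in _ * X = _]mxE mulrDr.
Qed.

Lemma diagonal_action1 : diagonal_action n (1%:M : 'M[R]_4) = 1%:M.
Proof.
apply/matrixP => k l; have [i r] := mxtens_indexP k; have [j s] := mxtens_indexP l.
rewrite tensmxE !mxE (inj_eq (can_inj (@mxtens_indexK _ _))) xpair_eqE.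
by rewrite -natrM mulnb.
Qed.

Lemma diagonal_actionZ x (a : 'M[R]_4) :
  diagonal_action n (x *: a) = x *: diagonal_action n a.
Proof.
apply/matrixP => k l; have [i r] := mxtens_indexP k; have [j s] := mxtens_indexP l.
by rewrite /diagonal_action [RHS]mxE !tensmxE [X in _ * X = _]mxE mulrCA.
Qed.

Lemma diagonal_action_sum (I : Type) (r : seq I) (P : pred I) (x : I -> R)
    (a : I -> 'M[R]_4) :
  diagonal_action n (\sum_(i <- r | P i) x i *: a i) =
  \sum_(i <- r | P i) x i *: diagonal_action n (a i).
Proof.
elim/big_rec2: _ => [|i y b _ <-]; last by rewrite diagonal_actionD diagonal_actionZ.
by rewrite -[0 in LHS](scale0r 0) diagonal_actionZ scale0r.
Qed.

Lemma mul_orbit_rows c q :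
  c *m orbit_rows q = (diagonal_action n (antisym_of c) *m q)^T.
Proof.
rewrite mulmx_sum_row /antisym_of diagonal_action_sum mulmx_suml linear_sum /=.
by apply: eq_bigr => p _; rewrite rowK -scalemxAl linearZ.
Qed.

(** An antisymmetric [a] kills [q] when it kills the span of the bodies. The congruence U a U^T,
    with [U] a basis whose first r rows span the bodies, turns this into the vanishing of the first
    r rows. A congruence keeps antisymmetry for any invertible [U], so the basis can be
    arbitrary. *)
Lemma orbit_rank q :
  \rank (orbit_rows q) = #|[pred p | (pair_nth p).1 <= \rank (config q)]%N|.
Proof.
(* [genmx] gives a 4 x 4 matrix with the same row space, so that the [pid_mx] of its factorisation
   is square. *)
set r := \rank (config q); pose Q := <<config q>>%MS.
have rQ : \rank Q = r by rewrite genmxE.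
pose U := row_ebase Q; have Uu : U \in unitmx by apply: row_ebase_unit.
have Ut : U^T \in unitmx by rewrite unitmx_tr.
pose D : 'M[R]_6 := diag_mx (\row_p ((pair_nth p).1 <= r)%N%:R).
transitivity (\rank D); last first.
  rewrite rank_diag_mx; apply: eq_card => p; rewrite !inE mxE.
  by case: (_ <= r)%N; rewrite ?oner_eq0 ?eqxx.
transitivity (\rank (antisym_congr U *m D)); last first.
  have := antisym_congr_free Uu; rewrite row_free_unit => u.
  by rewrite -(mxrank_tr (_ *m D)) trmx_mul mxrankMfree ?mxrank_tr // row_free_unit unitmx_tr.
apply: eq_rank_ker => c; rewrite mul_orbit_rows.
have -> : ((diagonal_action n (antisym_of c) *m q)^T = 0) = (Q *m antisym_of c = 0).
  apply/propext; split=> [/(congr1 trmx)|h].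
    rewrite trmxK trmx0 => /action_eq0; rewrite antisym_of_antisym mulmxN => /eqP.
    rewrite oppr_eq0 => /eqP /sub_kermxP h; apply/sub_kermxP.
    by rewrite genmxE.
  rewrite (_ : diagonal_action n (antisym_of c) *m q = 0) ?trmx0 //; apply/action_eq0.
  rewrite antisym_of_antisym mulmxN (_ : config q *m _ = 0) ?oppr0 //.
  by apply/sub_kermxP; rewrite -genmxE; apply/sub_kermxP.
have -> : (c *m (antisym_congr U *m D) = 0) =
    ((pid_mx r : 'M[R]_4) *m antisym_of (c *m antisym_congr U) = 0).
  apply/propext; split=> [/eqP h|/eqP].
    apply/eqP; rewrite antisym_of_top; apply/forallP => p; apply/implyP => lp.
    have /eqP/rowP/(_ p) := h; rewrite mulmxA mul_mx_diag [LHS]mxE [RHS]mxE.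
    by rewrite [X in _ * X]mxE lp mulr1 => ->.
  rewrite antisym_of_top => /forallP h; apply/rowP => p; rewrite mulmxA mul_mx_diag.
  have := h p; rewrite [LHS]mxE [RHS]mxE [X in _ * X]mxE.
  case: (_ <= r)%N => /=; last by rewrite mulr0.
  by move=> /eqP ->; rewrite mul0r.
rewrite mul_antisym_congr // -[Q]mulmx_ebase rQ -/U; split=> h.
  have Cu := col_ebase_unit Q.
  have := congr1 (mulmx (invmx (col_ebase Q))) h.
  by rewrite mulmx0 -!mulmxA mulKmx // !mulmxA => ->; rewrite mul0mx.
have : (pid_mx r : 'M[R]_4) *m U *m antisym_of c = 0.
  rewrite -[LHS](mulmxK Ut) (_ : _ *m U *m _ *m U^T = 0) ?mul0mx //.
  by rewrite -!mulmxA (mulmxA U).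
by move=> e; rewrite -!mulmxA (mulmxA (pid_mx r : 'M[R]_4)) e mulmx0.
Qed.

(** Three pairs start with 1, two with 2 and one with 3. The dimension is odd exactly when the
    bodies span at most a plane. *)
Lemma orbit_rank_cases q : q != 0 -> \rank (orbit_rows q) =
  (if \rank (config q) <= 1 then 3 else if \rank (config q) <= 2 then 5 else 6)%N.
Proof.
move=> q0; rewrite orbit_rank.
have : (0 < \rank (config q))%N.
  by rewrite lt0n mxrank_eq0; apply: contra q0 => /eqP/config_eq0 ->.
rewrite -sum1_card big_mkcond 6!big_ord_recl big_ord0 /=.
by case: (\rank (config q)) => [|[|[|[|k]]]].
Qed.
End OrbitRank.

Section Planarity.
Variables (R : realType) (n : nat).
Implicit Types q : 'cV[R]_(n * 4).

(** [planar] and [collinear] ask for dimension exactly k; a smaller span is completed by further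
    rows of an extended basis, whence k <= 4. *)
Lemma config_sub_subspace q k : (k <= 4)%N ->
  (\rank (config q) <= k)%N <->
  exists P : {vspace 'cV[R]_4}, \dim P = k /\ forall j, body q j \in P.
Proof.
move=> k4; split=> [rk|[P [<- qP]]]; last first.
  rewrite dim_vsrows; apply: mxrankS; apply/row_subP => j.
  by rewrite rowK sub_vsrows trmxK.
pose Q := <<config q>>%MS; pose W := (pid_mx k : 'M[R]_4) *m row_ebase Q.
exists (colspan W^T); split.
  rewrite dim_vsrows vsrows_colspan trmxK mxrankMfree ?row_free_unit ?row_ebase_unit //.
  by rewrite rank_pid_mx.
move=> j; rewrite -[body q j]trmxK -sub_vsrows vsrows_colspan trmxK.
have -> : (body q j)^T = row j (config q) by rewrite rowK.
apply: (submx_trans (row_sub j _)).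
apply: (@submx_trans _ _ _ _ _ _ Q); first by rewrite genmxE.
rewrite -[X in (X <= _)%MS]mulmx_ebase /W.
have -> : (pid_mx (\rank Q) : 'M[R]_4) =
    pid_mx (\rank Q) *m (pid_mx k : 'M[R]_4).
  by rewrite mul_pid_mx; congr pid_mx; rewrite /Q genmxE; have := rank_leq_col (config q); lia.
by rewrite -!mulmxA mulmxA submxMl.
Qed.

Lemma planarE q : planar q <-> (\rank (config q) <= 2)%N.
Proof. by rewrite (config_sub_subspace q). Qed.

Lemma collinearE q : collinear q <-> (\rank (config q) <= 1)%N.
Proof. by rewrite (config_sub_subspace q). Qed.

Lemma in_standard_plane_rank q : in_standard_plane q -> (\rank (config q) <= 2)%N.
Proof.
move=> qs; have -> : config q = config q *m (pid_mx 2 : 'M[R]_4).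
  apply/trmx_inj; rewrite trmx_mul tr_pid_mx; apply/matrixP => r j.
  rewrite pid_mx_mul_entry mxE mxE; case: ltnP => h; rewrite ?mul1r ?mul0r //.
  by rewrite mxE qs.
by apply: leq_trans (mxrankM_maxr _ _) _; rewrite rank_pid_mx.
Qed.

Lemma dim_orbit_tangent q : \dim (orbit_tangent q) = \rank (orbit_rows q).
Proof. by rewrite dim_vsrows (vsrows_span _ (0, 0)%N). Qed.

End Planarity.

(** * Parity of the index and of the nullity *)

Section TangentDecomposition.
Variables (R : realType) (n : nat) (m : 'I_n -> R) (q : 'cV[R]_(n * 4)).
Hypothesis n_gt0 : (0 < n)%N.
Hypothesis m_gt0 : forall i, 0 < m i.
Hypothesis q_cc : central_configuration m q.

Let M := massmx m.
Let rep := repeat_mx R n.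
Let H := hess_form m q.
Let M_sym : M^T = M := massmx_sym m.
Let M_gt0 := massmx_posdef m_gt0.
Let M_unit : M \in unitmx := massmx_unit m_gt0.

Lemma repeat_mxT : (repeat_mx R n)^T = \sum_j bodymx R j.
Proof.
apply/matrixP => s k; have [j r] := mxtens_indexP k.
rewrite mxE summxE (bigD1 j) //= big1 => [|i ij].
  rewrite addr0 /repeat_mx /tensmx !mxE mxtens_indexK /= mul1r.
  rewrite (inj_eq (can_inj (@mxtens_indexK _ _))) xpair_eqE eqxx /= eq_sym.
  by rewrite (_ : Ordinal _ = s) //; apply: val_inj; rewrite /= modn_small.
by rewrite !mxE (inj_eq (can_inj (@mxtens_indexK _ _))) xpair_eqE (negbTE ij).
Qed.

Lemma bodymx_mass j : bodymx R j *m M = m j *: bodymx R j.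
Proof.
rewrite mul_rowsub_mx mul1mx /M massmxE; apply/matrixP => r k.
rewrite !mxE; case: eqP => _; last by rewrite mulr0.
by rewrite mxtens_indexK mulr1n mulr1.
Qed.

Lemma repeat_action (a : 'M[R]_4) : rep^T *m diagonal_action n a = a *m rep^T.
Proof.
rewrite /rep repeat_mxT mulmx_suml mulmx_sumr; apply: eq_bigr => j _.
exact: bodymx_action.
Qed.

Lemma repeat_mass_q : rep^T *m M *m q = 0.
Proof.
have [_ cen _ _] := q_cc; rewrite /rep repeat_mxT !mulmx_suml -[RHS]cen.
by apply: eq_bigr => j _; rewrite bodymx_mass -scalemxAl bodymxE.
Qed.

Lemma rank_repeat : \rank rep^T = 4.
Proof.
apply/eqP; rewrite -[_ == _]/(row_free rep^T).
apply: inj_row_free => c c0; pose j := Ordinal n_gt0.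
have e : rep^T *m (bodymx R j)^T = 1%:M.
  rewrite /rep repeat_mxT mulmx_suml (bigD1 j) //= big1 => [|i ij].
    rewrite addr0 mul_rowsub_mx mul1mx; apply/matrixP => r s.
    by rewrite !mxE (inj_eq (can_inj (@mxtens_indexK _ _))) xpair_eqE eqxx eq_sym.
  rewrite mul_rowsub_mx mul1mx; apply/matrixP => r s.
  by rewrite !mxE (inj_eq (can_inj (@mxtens_indexK _ _))) xpair_eqE eq_sym (negbTE ij).
by rewrite -[c]mulmx1 -e mulmxA c0 mul0mx.
Qed.

Lemma q_neq0 : q != 0.
Proof.
have [_ _ q1 _] := q_cc; apply/eqP => q0.
by move: q1; rewrite q0 mulmx0 dotvE trmx0 mul0mx mxE => /eqP; rewrite eq_sym oner_eq0.
Qed.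

Lemma hess_form_sym : H^T = H.
Proof.
have [ncol _ _ _] := q_cc.
by rewrite /H /hess_form (hessianE _ ncol) linearD /= hessmx_sym linearZ /= massmx_sym.
Qed.

(** An abstract list of antisymmetric generators covers both definitions of E2. Beyond its end [nth]
    returns 0, which is antisymmetric too. *)
Variable t : seq 'M[R]_4.
Hypothesis t_anti : forall i, (nth 0 t i)^T = - nth 0 t i.

Definition action_rows (s : seq 'M[R]_4) (x : 'cV[R]_(n * 4)) : 'M[R]_(size s, n * 4) :=
  \matrix_i (diagonal_action n (nth 0 s i) *m x)^T.

Let O := action_rows t q.
Let X := col_mx rep^T (action_rows (1%:M :: t) q).
Let Z := kermx (M *m X^T).

Lemma action_rows_cons : (action_rows (1%:M :: t) q :=: q^T + O)%MS.
Proof.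
have act1 := diagonal_action1 R n.
apply/eqmxP/andP; split.
  apply/row_subP => -[[|i] hi]; rewrite rowK /= ?act1 ?mul1mx ?addsmxSl //.
  apply: submx_trans (addsmxSr _ _).
  by rewrite -[X in (X <= _)%MS](rowK (fun i : 'I_(size t) =>
    (diagonal_action n (nth 0 t i) *m q)^T) (Ordinal (hi : (i < size t)%N))) row_sub.
rewrite addsmx_sub; apply/andP; split.
  have <- : row ord0 (action_rows (1%:M :: t) q) = q^T.
    by rewrite rowK /= act1 mul1mx.
  exact: row_sub.
apply/row_subP => i; rewrite rowK.
have <- : row (lift ord0 i) (action_rows (1%:M :: t) q) =
    (diagonal_action n (nth 0 t i) *m q)^T by rewrite rowK.
exact: row_sub.
Qed.

Lemma q_mass_antisym (a : 'M[R]_4) : a^T = - a ->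
  q^T *m M *m (diagonal_action n a *m q) = 0.
Proof.
move=> aa; rewrite mulmxA -(mulmxA q^T) antisym_form_eq0 //.
by rewrite trmx_mul trmx_action aa M_sym -scaleN1r diagonal_actionZ scaleN1r mulNmx
  massmx_action.
Qed.

Lemma mul_action_rows k (W : 'M[R]_(k, n * 4)) :
  (forall i, W *m (diagonal_action n (nth 0 t i) *m q) = 0) -> W *m O^T = 0.
Proof.
move=> h; apply/trmx_inj; rewrite trmx_mul trmxK trmx0.
by apply/row_matrixP => i; rewrite row0 row_mul rowK -trmx_mul h trmx0.
Qed.

Lemma q_mass_action : q^T *m M *m O^T = 0.
Proof. by apply: mul_action_rows => i; apply: q_mass_antisym. Qed.

Lemma repeat_mass_action : rep^T *m M *m O^T = 0.
Proof.
apply: mul_action_rows => i; rewrite mulmxA -(mulmxA rep^T) massmx_action mulmxA.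
by rewrite repeat_action -!mulmxA (mulmxA rep^T) repeat_mass_q mulmx0.
Qed.

Lemma hess_form_action : H *m O^T = 0.
Proof. by apply: mul_action_rows => i; apply: cc_hessian_antisym. Qed.

(** Translations, [q] and its rotations are pairwise M-orthogonal; the 5 counts four translations
    and the scaling direction. *)
Lemma rank_generators : \rank X = (5 + \rank O)%N.
Proof.
have e : (X :=: rep^T + (q^T + O))%MS.
  by apply: eqmx_trans (adds_eqmx (eqmx_refl _) action_rows_cons); apply/eqmx_sym/addsmxE.
rewrite e (posdef_disjoint M_gt0); last first.
  have /submxP[C ->] : (q^T + O <= col_mx q^T O)%MS by rewrite addsmxE.
  rewrite trmx_mul tr_col_mx mulmxA mul_mx_row trmxK.
  by rewrite repeat_mass_q repeat_mass_action row_mx0 mul0mx.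
rewrite (posdef_disjoint M_gt0) ?q_mass_action // rank_repeat rank_rV.
suff -> : q^T != 0 by [].
by apply: contra q_neq0 => /eqP e0; rewrite -[q]trmxK e0 trmx0.
Qed.
Lemma rank_complement : \rank Z = (n * 4 - (5 + \rank O))%N.
Proof.
rewrite mxrank_ker -rank_generators -(mxrank_tr (M *m _)) trmx_mul trmxK.
by rewrite mxrankMfree ?mxrank_tr // row_free_unit unitmx_tr.
Qed.

Lemma rank_generators_le : (5 + \rank O <= n * 4)%N.
Proof. by rewrite -rank_generators rank_leq_col. Qed.

Lemma complement_mul (k : nat) (Y : 'M[R]_(k, n * 4)) : (Y <= X)%MS -> Z *m M *m Y^T = 0.
Proof.
by move=> /submxP[C ->]; rewrite trmx_mul mulmxA -(mulmxA Z) mulmx_ker mul0mx.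
Qed.

Lemma generators_sub : [/\ (rep^T <= X)%MS, (q^T <= X)%MS & (O <= X)%MS].
Proof.
rewrite /X -!addsmxE; split; first exact: addsmxSl.
  by apply: submx_trans (addsmxSr _ _); rewrite action_rows_cons addsmxSl.
by apply: submx_trans (addsmxSr _ _); rewrite action_rows_cons addsmxSr.
Qed.

(** [Z] and [O] are M-orthogonal and contained in T_q; their ranks add up to 4n - 5, the dimension
    of T_q. *)
Lemma tangent_rows : (vsrows (tangent_space m q) :=: col_mx Z O)%MS.
Proof.
have [repX qX OX] := generators_sub.
have tangE (x : 'rV[R]_(n * 4)) : (x <= vsrows (tangent_space m q))%MS =
    (x *m M *m rep == 0) && (x *m M *m q == 0).
  have trE k (A : 'M[R]_(k, n * 4)) : (A *m x^T == 0) = (x *m A^T == 0).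
    by apply/eqP/eqP => h; apply/trmx_inj; rewrite trmx_mul ?trmxK h trmx0.
  by rewrite sub_vsrows memv_cap !memv_colker !trE trmx_mul !trmxK M_sym !mulmxA.
have sub : (col_mx Z O <= vsrows (tangent_space m q))%MS.
  rewrite col_mx_sub; apply/andP; split; apply/row_subP => i; rewrite tangE -!row_mul.
    have := complement_mul repX; have := complement_mul qX; rewrite !trmxK => -> ->.
    by rewrite !row0 !eqxx.
  have e1 : O *m M *m rep = 0.
    by apply/trmx_inj; rewrite !trmx_mul M_sym mulmxA repeat_mass_action trmx0.
  have e2 : O *m M *m q = 0.
    by apply/trmx_inj; rewrite !trmx_mul M_sym mulmxA q_mass_action trmx0.
  by rewrite e1 e2 !row0 !eqxx.
apply/eqmx_sym/eqmxP; rewrite sub -(geq_leqif (mxrank_leqif_sup sub)) andTb.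
rewrite -addsmxE (posdef_disjoint M_gt0); last exact: complement_mul.
rewrite rank_complement.
have -> : \rank (vsrows (tangent_space m q)) = (n * 4 - 5)%N.
  have -> : (vsrows (tangent_space m q) :=: kermx (M *m (col_mx rep^T q^T)^T))%MS.
    apply: eqmx_rows => x; rewrite tangE tr_col_mx !trmxK mul_mx_row.
    apply/andP/sub_kermxP; rewrite mul_mx_row !mulmxA.
      by case=> /eqP -> /eqP ->; rewrite row_mx0.
    by rewrite -row_mx0 => /eq_row_mx[-> ->]; rewrite !eqxx.
  rewrite mxrank_ker -(mxrank_tr (M *m _)) trmx_mul trmxK mxrankMfree; last first.
    by rewrite row_free_unit unitmx_tr.
  rewrite -addsmxE (posdef_disjoint M_gt0) ?trmxK ?repeat_mass_q // rank_repeat rank_rV.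
  suff -> : q^T != 0 by [].
  by apply: contra q_neq0 => /eqP e0; rewrite -[q]trmxK e0 trmx0.
by have := rank_generators_le; lia.
Qed.

Lemma n_minusE : n_minus m q = ind H Z.
Proof.
rewrite /n_minus morse_indexE ?hess_form_sym // (ind_eqmx hess_form_sym tangent_rows).
rewrite ind_col_mx ?hess_form_sym //; last by rewrite -mulmxA hess_form_action mulmx0.
rewrite [X in (_ + X)%N](_ : _ = 0%N) ?addn0 // /ind.
rewrite -mulmxA hess_form_action mulmx0.
apply: neg_eigenvalues_posdef => [|x]; first by rewrite trmx0.
by rewrite mulmx0 mul0mx mxE.
Qed.

(** As [O] lies in the kernel of [H], the rank of [H] on T_q is already attained on [Z]. *)
Lemma n_zeroE : (n_zero m q + \rank (Z *m H *m Z^T) = n * 4 - 5)%N.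
Proof.
have symNH : (- H)^T = - H by rewrite linearN /= hess_form_sym.
rewrite /n_zero nullityE ?hess_form_sym //.
have rT : \dim (tangent_space m q) = (n * 4 - 5)%N.
  rewrite dim_vsrows tangent_rows -addsmxE (posdef_disjoint M_gt0).
    by rewrite rank_complement; have := rank_generators_le; lia.
  by apply: complement_mul; have [] := generators_sub.
have -> : \rank (vsrows (tangent_space m q) *m H *m (vsrows (tangent_space m q))^T) =
    \rank (Z *m H *m Z^T).
  rewrite !rank_ind ?hess_form_sym // (ind_eqmx hess_form_sym tangent_rows).
  rewrite (ind_eqmx symNH tangent_rows).
  have OH : Z *m H *m O^T = 0 by rewrite -mulmxA hess_form_action mulmx0.
  rewrite !ind_col_mx ?hess_form_sym //; last by rewrite mulmxN mulNmx OH oppr0.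
  have z0 (A : 'M[R]_(n * 4)) : A *m O^T = 0 -> ind A O = 0%N.
    move=> A0; rewrite /ind -mulmxA A0 mulmx0.
    apply: neg_eigenvalues_posdef => [|x]; first by rewrite trmx0.
    by rewrite mulmx0 mul0mx mxE.
  have HO := hess_form_action.
  have NHO : - H *m O^T = 0 by rewrite mulNmx HO oppr0.
  by rewrite (z0 _ HO) (z0 _ NHO) !addn0.
rewrite subnK ?rT // -rT dim_vsrows -mulmxA; apply: leq_trans (mxrankM_maxl _ _) _.
by rewrite tangent_rows -addsmxE mxrankS // addsmxSl.
Qed.
End TangentDecomposition.

Section Generators.
Variables (R : realType) (n : nat) (m : 'I_n -> R) (q : 'cV[R]_(n * 4)).
Let M := massmx m.

Lemma vsrows_E1 :
  (vsrows (E1 m) :=: row_mx (repeat_mx R n)^T 0 + row_mx 0 ((repeat_mx R n)^T *m M))%MS.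
Proof.
apply: eqmx_trans (vsrows_colspan _) _; rewrite tr_block_mx !trmx0 trmx_mul massmx_sym.
by apply: eqmx_sym; apply: addsmxE.
Qed.

Lemma vsrows_action_span (s : seq 'M[R]_4) :
  (vsrows (action_span m s q) :=:
   row_mx (action_rows s q) 0 + row_mx 0 (action_rows s q *m M))%MS.
Proof.
apply: eqmx_trans (vsrows_add _ _) _; apply: adds_eqmx.
  apply: eqmx_trans (vsrows_span _ 0 _) _.
  rewrite (_ : \matrix_(i < _) _ = row_mx (action_rows s q) 0) //.
  apply/row_matrixP => i; rewrite row_row_mx !rowK tr_col_mx trmx0.
  by congr row_mx; apply/rowP => j; rewrite !mxE.
apply: eqmx_trans (vsrows_span _ 0 _) _.
rewrite (_ : \matrix_(i < _) _ = row_mx 0 (action_rows s q *m M)) //.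
apply/row_matrixP => i; rewrite row_row_mx row_mul !rowK tr_col_mx trmx0 trmx_mul.
by rewrite massmx_sym; congr row_mx; apply/rowP => j; rewrite !mxE.
Qed.

(** Regroups the generators of E1 and E2 into positions X and momenta M X, the shape needed by
    [symplectic_rows]. *)
Lemma vsrows_generators (s : seq 'M[R]_4) :
  let X := col_mx (repeat_mx R n)^T (action_rows s q) in
  (vsrows (E1 m + action_span m s q)%VS :=: block_mx X 0 0 (X *m M))%MS.
Proof.
move=> X; apply: eqmx_trans (vsrows_add _ _) _.
apply: eqmx_trans (adds_eqmx vsrows_E1 (vsrows_action_span s)) _.
set a := (repeat_mx R n)^T; set b := action_rows s q.
have eX : (row_mx a (0 : 'M[R]_(4, n * 4)) + row_mx b (0 : 'M[R]_(_, n * 4)) :=: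
    row_mx X (0 : 'M[R]_(_, n * 4)))%MS.
  by apply: eqmx_trans (addsmxE _ _) _; rewrite -block_mxEv block_mxEh col_mx0.
have eY : (row_mx (0 : 'M[R]_(4, n * 4)) (a *m M)
    + row_mx (0 : 'M[R]_(_, n * 4)) (b *m M) :=:
    row_mx (0 : 'M[R]_(_, n * 4)) (X *m M))%MS.
  apply: eqmx_trans (addsmxE _ _) _.
  by rewrite -block_mxEv block_mxEh col_mx0 /X mul_col_mx.
apply: eqmx_trans (_ : (_ :=: row_mx X 0 + row_mx 0 (X *m M))%MS) _; last exact: addsmxE.
apply: eqmx_trans (adds_eqmx eX eY).
by rewrite -!addsmxA (addsmxA (row_mx 0 (a *m M))) (addsmxC (row_mx 0 (a *m M)))
  -!addsmxA.
Qed.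
End Generators.

(** Here h1, h2 and z are n^-, n^+ and the nullity of H; their sum 4n - 5 is odd. *)
Lemma index_parity n r h1 h2 z : (5 + r <= n * 4)%N ->
  (z + (h1 + h2) = n * 4 - 5)%N -> odd h2 = ~~ odd (h1 + z).
Proof. lia. Qed.

(** For odd r the rank 4n - 5 - r of Z is even, so the rank of B3 has the parity of h1 + h2 = 4n - 5
    - z. *)
Lemma nullity_parity n r g1 g2 h1 h2 z : odd r -> (5 + r <= n * 4)%N ->
  odd g1 = odd h1 -> odd g2 = odd h2 -> (z + (h1 + h2) = n * 4 - 5)%N ->
  odd (g1 + g2 + (n * 4 - (5 + r))) = ~~ odd z.
Proof. lia. Qed.

Lemma double_dim n r :
  (n * 4 - (5 + r) + (n * 4 - (5 + r)) = 8 * n - 10 - 2 * r)%N.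
Proof. lia. Qed.

Section Parity.
Variables (R : realType) (n : nat) (m : 'I_n -> R) (q : 'cV[R]_(n * 4)).
Hypothesis n_gt0 : (0 < n)%N.
Hypothesis m_gt0 : forall i, 0 < m i.
Hypothesis q_cc : central_configuration m q.
Let M := massmx m.
Let D := hessian (potential m) q.
Let H := hess_form m q.

Variable t : seq 'M[R]_4.
Hypothesis t_anti : forall i, (nth 0 t i)^T = - nth 0 t i.
Let O := action_rows t q.
Hypothesis rank_odd : odd (\rank O).

Let X := col_mx (repeat_mx R n)^T (action_rows (1%:M :: t) q).
Let Z := kermx (M *m X^T).

Variable K : 'M[R]_(n * 4).
Hypothesis K_anti : K^T = - K.
Hypothesis ZK : (Z *m K <= Z)%MS.
Let G := D - K *m M *m K.
(** The comparison of G with H that each kind of equilibrium must supply: the forms coincide for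
    [Kd], and for [Ks] the parities of their indices agree. *)
Hypothesis G_parity : odd (ind G Z) = odd (ind H Z).
Hypothesis NG_parity : odd (ind (- G) Z) = odd (ind (- H) Z).

Variables (d : nat) (S : 'M[R]_(n * 4 + n * 4, d + d)) (L3 : 'M[R]_(d + d)).
Hypothesis S_basis :
  symplectic_basis S (omega_orth (E1 m + action_span m (1%:M :: t) q)%VS).
Hypothesis LS : block_mx K (invmx M) D K *m S = S *m L3.
Let B3 := Jstd R d *m L3.

Lemma restricted_parity :
  [/\ B3^T = B3,
      odd (neg_eigenvalues B3) = ~~ odd (n_minus m q + n_zero m q),
      odd (\rank B3) = ~~ odd (n_zero m q)
    & (d + d = 8 * n - 10 - 2 * \rank O)%N].
Proof.
have M_sym : M^T = M := massmx_sym m.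
have M_gt0 := massmx_posdef m_gt0; have M_unit : M \in unitmx := massmx_unit m_gt0.
have D_sym : D^T = D.
  have [ncol _ _ _] := q_cc; rewrite /D (hessianE _ ncol).
  exact: hessmx_sym.
have H_sym : H^T = H := hess_form_sym q_cc.
have [S_symp S_rows] := symplectic_rows M_sym M_unit (vsrows_generators _ _ _) S_basis.
have G_s : G^T = G by apply: reduced_form_sym.
have neg3 : neg_eigenvalues B3 = ind (- G) Z :=
  neg_B3 M_sym M_gt0 M_unit D_sym K_anti ZK S_symp S_rows LS.
have rank3 : \rank B3 = (\rank (Z *m G *m Z^T) + \rank Z)%N :=
  rank_B3 M_sym M_gt0 M_unit D_sym K_anti ZK S_symp S_rows LS.
have dim3 : (d + d = \rank Z + \rank Z)%N := dim_B3 M_unit S_symp S_rows.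
have rZ : \rank Z = (n * 4 - (5 + \rank O))%N := rank_complement n_gt0 m_gt0 q_cc t_anti.
have le5 : (5 + \rank O <= n * 4)%N := rank_generators_le n_gt0 m_gt0 q_cc t_anti.
have nm : n_minus m q = ind H Z := n_minusE n_gt0 m_gt0 q_cc t_anti.
have nz : (n_zero m q + \rank (Z *m H *m Z^T) = n * 4 - 5)%N :=
  n_zeroE n_gt0 m_gt0 q_cc t_anti.
have rG : \rank (Z *m G *m Z^T) = (ind G Z + ind (- G) Z)%N := rank_ind Z G_s.
have rH : \rank (Z *m H *m Z^T) = (ind H Z + ind (- H) Z)%N := rank_ind Z H_sym.
split; first exact: (B3_sym M_sym D_sym K_anti S_symp LS).
- by rewrite neg3 NG_parity nm; apply: index_parity le5 _; rewrite -rH.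
- rewrite rank3 rG rZ; apply: nullity_parity rank_odd le5 G_parity NG_parity _.
  by rewrite -rH.
- by rewrite dim3 rZ; apply: double_dim.
Qed.
End Parity.

(* Products of 4 x 4 integer matrices given by rows, so that the identities
   between rotation generators and quaternions hold by computation. *)
Section IntegerMatrices.
Implicit Types s t : seq (seq int).

Definition ient s i j : int := nth 0 (nth [::] s i) j.
Definition imx (f : nat -> nat -> int) : seq (seq int) :=
  mkseq (fun i => mkseq (f i) 4) 4.
Definition imul s t := imx (fun i j =>
  ient s i 0 * ient t 0 j + ient s i 1 * ient t 1 j
  + ient s i 2 * ient t 2 j + ient s i 3 * ient t 3 j).
Definition iscale x s := imx (fun i j => x * ient s i j).
Definition iadd s t := imx (fun i j => ient s i j + ient t i j).
Definition itr s := imx (fun i j => ient s j i).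
Definition ikrot l r := imx (fun a b =>
  ((a.+1 == r) && (b.+1 == l))%:Z - ((a.+1 == l) && (b.+1 == r))%:Z).
Definition ipid r := imx (fun a b => ((a == b) && (a < r)%N)%:Z).

Variable R : realType.

Lemma ient_imx f (i j : 'I_4) : ient (imx f) i j = f i j.
Proof. by rewrite /ient /imx nth_mkseq // nth_mkseq. Qed.

Lemma mx4_imx f : mx4 R (imx f) = \matrix_(i, j) (f i j)%:~R.
Proof. by apply/matrixP => i j; rewrite !mxE -/(ient _ _ _) ient_imx. Qed.

Lemma mx4_mul s t : mx4 R s *m mx4 R t = mx4 R (imul s t).
Proof.
rewrite mx4_imx; apply/matrixP => i j; rewrite mxE 4!big_ord_recl big_ord0 !mxE /=.
by rewrite !rmorphD !rmorphM /= addr0 !addrA.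
Qed.

Lemma mx4_scale (x : int) s : x%:~R *: mx4 R s = mx4 R (iscale x s).
Proof. by rewrite mx4_imx; apply/matrixP => i j; rewrite !mxE rmorphM. Qed.

Lemma mx4_add s t : mx4 R s + mx4 R t = mx4 R (iadd s t).
Proof. by rewrite mx4_imx; apply/matrixP => i j; rewrite !mxE rmorphD. Qed.

Lemma mx4_tr s : (mx4 R s)^T = mx4 R (itr s).
Proof. by rewrite mx4_imx; apply/matrixP => i j; rewrite !mxE. Qed.

Lemma mx4_opp s : - mx4 R s = mx4 R (iscale (-1) s).
Proof. by rewrite -mx4_scale rmorphN scaleN1r. Qed.

Lemma Krot_mx4 l r : Krot R l r = mx4 R (ikrot l r).
Proof. by rewrite mx4_imx; apply/matrixP => i j; rewrite !mxE rmorphB. Qed.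

Lemma pid_mx4 r : pid_mx r = mx4 R (ipid r).
Proof. by rewrite mx4_imx; apply/matrixP => i j; rewrite !mxE. Qed.

Lemma mx4_1 : 1%:M = mx4 R (ipid 4).
Proof. by rewrite -pid_mx4 pid_mx_1. Qed.

Lemma mx4_0 : 0 = mx4 R (ipid 0).
Proof. by rewrite -pid_mx4 pid_mx_0. Qed.

(* Left multiplication by a maps every generator in S, restricted to the range
   of p, to 0 or to plus or minus another one. *)
Definition istable a p (S : seq (seq (seq int))) :=
  all (fun s => has (fun x => has (fun s' =>
    imul (imul a s) p == iscale x (imul s' p)) S) [:: 0; 1; -1]) S.
End IntegerMatrices.

Section Stable.
Variables (R : realType) (n : nat) (m : 'I_n -> R) (q : 'cV[R]_(n * 4)).
Let M := massmx m.

Lemma diagonal_actionM (a b : 'M[R]_4) :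
  diagonal_action n (a *m b) = diagonal_action n a *m diagonal_action n b.
Proof. by rewrite /diagonal_action tensmx_mul mulmx1. Qed.

(** The action of [a] preserves X and commutes with [M], and a is antisymmetric or not, Z A M X^T =
    Z M (X A^T)^T = 0. The projection [p] fixes [q], so relations between generators are tested on
    its range. *)
Lemma complement_stable (S : seq (seq (seq int))) a p :
  diagonal_action n (mx4 R p) *m q = q -> istable a p S ->
  stablemx (kermx (M *m (col_mx (repeat_mx R n)^T
    (action_rows (map (mx4 R) S) q))^T)) (diagonal_action n (mx4 R a)).
Proof.
move=> pq st; set X := col_mx _ _; set Z := kermx _.
have stab := allP st; set A := diagonal_action n _.
have XA : (X *m A^T <= X)%MS.
  rewrite /X mul_col_mx trmx_action repeat_action col_mx_sub -!addsmxE.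
  apply/andP; split; first by apply: submx_trans (submxMl _ _) (addsmxSl _ _).
  apply: (submx_trans _ (addsmxSr _ _)); apply/row_subP => i.
  have iS : (i < size S)%N by rewrite -[size S](size_map (mx4 R)).
  rewrite row_mul rowK (nth_map [::]) //; set s := nth _ _ _.
  have /stab/hasP[x _ /hasP[s' s'S /eqP e]] : s \in S by apply: mem_nth.
  have e' : mx4 R a *m mx4 R s *m mx4 R p = x%:~R *: (mx4 R s' *m mx4 R p).
    by rewrite !mx4_mul e mx4_scale.
  have -> : (diagonal_action n (mx4 R s) *m q)^T *m diagonal_action n (mx4 R a)^T =
      x%:~R *: (diagonal_action n (mx4 R s') *m q)^T.
    rewrite -trmx_action -trmx_mul -[in LHS]pq !mulmxA -!diagonal_actionM e'.
    rewrite diagonal_actionZ diagonal_actionM -scalemxAl -mulmxA pq.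
    by rewrite linearZ.
  apply: scalemx_sub.
  have jS : (index s' S < size (map (mx4 R) S))%N by rewrite size_map index_mem.
  have <- : row (Ordinal jS) (action_rows (map (mx4 R) S) q) =
      (diagonal_action n (mx4 R s') *m q)^T.
    by rewrite rowK (nth_map [::]) ?index_mem // nth_index.
  exact: row_sub.
apply/sub_kermxP; have /submxP[C XC] := XA.
have -> : Z *m A *m (M *m X^T) = Z *m M *m (X *m A^T)^T.
  by rewrite trmx_mul trmxK -!mulmxA (mulmxA A) /A -massmx_action -!mulmxA.
by rewrite XC trmx_mul mulmxA -(mulmxA Z) mulmx_ker mul0mx.
Qed.
End Stable.

(** * Pairing of the directions normal to a plane *)

Section PlanarParity.
(** Here [E3] and [E4] model the projections to the third and fourth coordinates (not the subspace
    E3), [J] the rotation of the (3,4)-plane, and [P] the horizontal projection. *)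
Variables (R : realType) (N : nat) (A E3 E4 J : 'M[R]_N) (k : nat) (Z : 'M[R]_(k, N)).
Hypothesis A_sym : A^T = A.
Hypothesis E3_sym : E3^T = E3.
Hypothesis E4_sym : E4^T = E4.
Hypothesis E3_idem : E3 *m E3 = E3.
Hypothesis E4_idem : E4 *m E4 = E4.
Hypothesis E34 : E3 *m E4 = 0.
Hypothesis E3J : E3 *m J = J *m E4.
Hypothesis E4J : E4 *m J = J *m E3.
Hypothesis JJ : E4 *m J *m J = - E4.
Hypothesis JJT : J *m J^T = E3 + E4.
Hypothesis AE3 : A *m E3 = E3 *m A.
Hypothesis AE4 : A *m E4 = E4 *m A.
Hypothesis AJ : A *m J = J *m A.
Hypothesis ZE3 : (Z *m E3 <= Z)%MS.
Hypothesis ZE4 : (Z *m E4 <= Z)%MS.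
Hypothesis ZJ : (Z *m J <= Z)%MS.
Let P := 1%:M - E3 - E4.

Lemma projections_orth : E4 *m E3 = 0.
Proof. by apply/trmx_inj; rewrite trmx_mul E3_sym E4_sym E34 trmx0. Qed.

Lemma split_rows : (Z :=: col_mx (Z *m P) (col_mx (Z *m E3) (Z *m E4)))%MS.
Proof.
have ZP : (Z *m P <= Z)%MS.
  rewrite /P -addrA -opprD mulmxBr mulmx1 mulmxDr addmx_sub // eqmx_opp.
  exact: addmx_sub.
apply/eqmxP; rewrite !col_mx_sub ZP ZE3 ZE4 andbT /= andbT.
have {1}-> : Z = Z *m P + (Z *m E3 + Z *m E4).
  rewrite -!mulmxDr (_ : P = 1%:M - (E3 + E4)) ?subrK ?mulmx1 //.
  by rewrite /P opprD addrA.
rewrite -!addsmxE; apply: submx_trans (addmx_sub_adds (submx_refl _) _) _.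
  exact: (addmx_sub_adds (submx_refl _) (submx_refl _)).
by apply: addsmxS => //; rewrite addsmxE.
Qed.

Lemma normal_rows : (Z *m E4 :=: Z *m E3 *m J)%MS.
Proof.
have /submxP[C eC] := ZJ; apply/eqmxP/andP; split.
  have -> : Z *m E4 = - (C *m (Z *m E3 *m J)).
    have -> : C *m (Z *m E3 *m J) = Z *m (E4 *m J *m J).
      by rewrite E4J !mulmxA -eC.
    by rewrite JJ mulmxN opprK.
  by rewrite eqmx_opp submxMl.
by rewrite -mulmxA E3J mulmxA eC -mulmxA submxMl.
Qed.

(** The three parts of Z are [A]-orthogonal, and [J], isometric and commuting with [A], carries the
    third-coordinate part onto the fourth; their equal indices cancel modulo 2. *)
Lemma odd_ind_planar : odd (ind A Z) = odd (ind A (Z *m P)).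
Proof.
rewrite (ind_eqmx A_sym split_rows).
have AP : A *m P = P *m A by rewrite /P !mulmxBl !mulmxBr mulmx1 mul1mx AE3 AE4.
have P_sym : P^T = P by rewrite /P !linearB /= trmx1 E3_sym E4_sym.
have PE3 : P *m E3 = 0 by rewrite /P !mulmxBl mul1mx E3_idem projections_orth subr0 subrr.
have PE4 : P *m E4 = 0 by rewrite /P !mulmxBl mul1mx E4_idem E34 subr0 subrr.
rewrite ind_col_mx //; last first.
  rewrite tr_col_mx !trmx_mul E3_sym E4_sym mul_mx_row.
  rewrite -!(mulmxA Z) -AP -!mulmxA (mulmxA P) PE3 (mulmxA P) PE4 !mul0mx !mulmx0.
  by rewrite row_mx0.
rewrite ind_col_mx //; last first.
  by rewrite trmx_mul E4_sym -!(mulmxA Z) -AE3 -!mulmxA (mulmxA E3) E34 mul0mx !mulmx0.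
rewrite (ind_eqmx A_sym normal_rows).
have -> : ind A (Z *m E3 *m J) = ind A (Z *m E3).
  rewrite /ind !trmx_mul E3_sym; congr neg_eigenvalues.
  have -> : Z *m E3 *m J *m A *m (J^T *m (E3 *m Z^T)) =
     Z *m E3 *m A *m (J *m J^T) *m E3 *m Z^T.
    by rewrite !mulmxA -(mulmxA _ J A) -AJ !mulmxA.
  rewrite JJT mulmxDr mulmxDl -(mulmxA _ E4 E3) projections_orth mulmx0 addr0.
  by rewrite -(mulmxA _ E3 E3) E3_idem !mulmxA.
by rewrite oddD addnn odd_double addbF.
Qed.
End PlanarParity.

(** * Generators of the two kinds of relative equilibria *)

Definition iquat_i : seq (seq int) :=
  [:: [:: 0; -1; 0; 0]; [:: 1; 0; 0; 0]; [:: 0; 0; 0; 1]; [:: 0; 0; -1; 0]].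
Definition iquat_j : seq (seq int) :=
  [:: [:: 0; 0; 1; 0]; [:: 0; 0; 0; 1]; [:: -1; 0; 0; 0]; [:: 0; -1; 0; 0]].
Definition iquat_k : seq (seq int) :=
  [:: [:: 0; 0; 0; -1]; [:: 0; 0; 1; 0]; [:: 0; -1; 0; 0]; [:: 1; 0; 0; 0]].

Section RelativeEquilibria.
Variables (R : realType) (n : nat) (m : 'I_n -> R) (q : 'cV[R]_(n * 4)).

Definition quaternions : seq 'M[R]_4 := [:: quat_i R; quat_j R; quat_k R].

Definition standard_rotations : seq 'M[R]_4 :=
  [seq Krot R p.1 p.2 | p <- planar_pairs].

Lemma mul_action_rows_sum (s : seq 'M[R]_4) c :
  c *m action_rows s q =
  (diagonal_action n (\sum_(i < size s) c 0 i *: nth 0 s i) *m q)^T.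
Proof.
rewrite mulmx_sum_row diagonal_action_sum mulmx_suml linear_sum /=.
by apply: eq_bigr => p _; rewrite rowK -scalemxAl linearZ.
Qed.

(** A combination of i, j, k squares to minus the sum of the squared coefficients, so it kills a
    nonzero [q] only if it is zero. *)
Lemma quaternions_rank : q != 0 -> \rank (action_rows quaternions q) = 3.
Proof.
move=> q0; apply/eqP; rewrite -[_ == _]/(row_free _); apply: inj_row_free => c.
rewrite mul_action_rows_sum 3!big_ord_recl big_ord0 addr0 /=.
set c0 := c 0 _; set c1 := c 0 _; set c2 := c 0 _.
set A := _ + _ => /(congr1 trmx); rewrite trmxK trmx0 => Aq.
have AA : A *m A = (- (c0 ^+ 2 + c1 ^+ 2 + c2 ^+ 2)) *: 1%:M.
  apply/matrixP => -[[|[|[|[|//]]]] hi] [[|[|[|[|//]]]] hj];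
    rewrite mxE 4!big_ord_recl big_ord0 !mxE /=; ring.
have : (- (c0 ^+ 2 + c1 ^+ 2 + c2 ^+ 2)) *: q == 0.
  have := congr1 (mulmx (diagonal_action n A)) Aq; rewrite mulmx0 mulmxA.
  by rewrite -diagonal_actionM AA diagonal_actionZ diagonal_action1 -scalemxAl mul1mx => ->.
rewrite scaler_eq0 (negbTE q0) orbF oppr_eq0.
have := sqr_ge0 c0; have := sqr_ge0 c1; have := sqr_ge0 c2 => h2 h1 h0 /eqP hs.
have z0 : c0 = 0 by apply/eqP; rewrite -sqrf_eq0; apply/eqP; lra.
have z1 : c1 = 0 by apply/eqP; rewrite -sqrf_eq0; apply/eqP; lra.
have z2 : c2 = 0 by apply/eqP; rewrite -sqrf_eq0; apply/eqP; lra.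
apply/rowP => i; rewrite [RHS]mxE.
case: i => -[|[|[|//]]] hi; [rewrite -[RHS]z0 | rewrite -[RHS]z1 | rewrite -[RHS]z2];
  by congr (c _ _); apply: val_inj.
Qed.

(** The opposite signs of the two blocks make [Kd] a multiple of the quaternion i. *)
Lemma Kd_action : Kd m q = freq m q *: diagonal_action n (quat_i R).
Proof.
rewrite /Kd -diagonal_actionZ; congr (diagonal_action n _).
apply/matrixP => i j; rewrite !mxE; case: splitP => i' hi; rewrite !mxE;
  case: splitP => j' hj; rewrite !mxE hi hj;
  case: i' {hi} => -[|[|//]] hi; case: j' {hj} => -[|[|//]] hj /=; ring.
Qed.

Lemma Ks_action : Ks m q = freq m q *: diagonal_action n (Krot R 1 2).
Proof.
rewrite /Ks -diagonal_actionZ; congr (diagonal_action n _).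
apply/matrixP => i j; rewrite !mxE; case: splitP => i' hi; rewrite !mxE;
  case: splitP => j' hj; rewrite !mxE hi hj;
  case: i' {hi} => -[|[|//]] hi; case: j' {hj} => -[|[|//]] hj /=; ring.
Qed.
End RelativeEquilibria.

(** * The non-planar and the planar equilibrium *)

Section Cases.
Variables (R : realType) (n : nat) (m : 'I_n -> R) (q : 'cV[R]_(n * 4)).
Hypothesis n_gt0 : (0 < n)%N.
Hypothesis m_gt0 : forall i, 0 < m i.
Hypothesis q_cc : central_configuration m q.
Let M := massmx m.
Let D := hessian (potential m) q.
Let H := hess_form m q.

Variables (d : nat) (S : 'M[R]_(n * 4 + n * 4, d + d)) (L3 : 'M[R]_(d + d)).
Hypothesis S_basis : symplectic_basis S (E3 m q).
Hypothesis LS : Lstar m q *m S = S *m L3.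
Let B3 := Jstd R d *m L3.

Lemma nth_antisym (s : seq (seq (seq int))) :
  all (fun a => itr a == iscale (-1) a) s ->
  forall i, (nth 0 (map (mx4 R) s) i)^T = - nth 0 (map (mx4 R) s) i.
Proof.
move=> /allP h i; have [si|si] := ltnP i (size s); last first.
  by rewrite nth_default ?size_map // trmx0 oppr0.
by rewrite (nth_map [::]) // mx4_tr (eqP (h _ (mem_nth _ si))) mx4_opp.
Qed.

Lemma freq_sq : freq m q * freq m q = potential m q.
Proof. by rewrite -expr2 sqr_sqrtr ?potential_ge0. Qed.

(** Since k^2 = U, the term - K M K is U M when a^2 = -1, which gives G = H; for the rotation (1,2)
    it is U M restricted to the horizontal plane. *)
Lemma gyroscopic_form (a : 'M[R]_4) :
  (freq m q *: diagonal_action n a) *m M *m (freq m q *: diagonal_action n a) =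
  potential m q *: (M *m diagonal_action n (a *m a)).
Proof.
rewrite -scalemxAl -massmx_action -scalemxAl -scalemxAr scalerA freq_sq.
by rewrite diagonal_actionM mulmxA.
Qed.

Lemma nonplanar_parity : ~ planar_RE m q ->
  [/\ B3^T = B3,
      odd (neg_eigenvalues B3) = ~~ odd (n_minus m q + n_zero m q),
      odd (\rank B3) = ~~ odd (n_zero m q)
    & (d + d = 8 * n - 16)%N].
Proof.
move=> npl; pose t := quaternions R.
pose ts := [:: iquat_i; iquat_j; iquat_k].
have e1 : 1%:M :: t = map (mx4 R) (ipid 4 :: ts) by rewrite /= -mx4_1.
have t_anti i : (nth 0 t i)^T = - nth 0 t i by apply: (@nth_antisym ts).
have rO : \rank (action_rows t q) = 3 by apply: quaternions_rank (q_neq0 q_cc).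
pose K := Kd m q.
have eL : block_mx K (invmx M) D K *m S = S *m L3.
  by move: LS; rewrite /Lstar /Kstar asboolF.
have eS : symplectic_basis S (omega_orth (E1 m + action_span m (1%:M :: t) q)%VS).
  by move: S_basis; rewrite /E3 /E2 asboolF.
have qi : (quat_i R)^T = - quat_i R by have := t_anti 0.
have K_anti : K^T = - K.
  by rewrite /K Kd_action linearZ /= trmx_action qi -scaleN1r diagonal_actionZ
    scaleN1r scalerN.
have ZK : (kermx (M *m (col_mx (repeat_mx R n)^T (action_rows (1%:M :: t) q))^T) *m K
   <= kermx (M *m (col_mx (repeat_mx R n)^T (action_rows (1%:M :: t) q))^T))%MS.
  rewrite /K Kd_action -scalemxAr scalemx_sub // e1.
  apply: (@complement_stable _ _ _ _ _ iquat_i (ipid 4)).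
    by rewrite -mx4_1 diagonal_action1 mul1mx.
  by vm_compute.
have GH : D - K *m M *m K = H.
  rewrite /K Kd_action gyroscopic_form.
  have -> : quat_i R *m quat_i R = (-1) *: 1%:M.
    rewrite -[quat_i R]/(mx4 R iquat_i) mx4_mul -[-1]/((-1)%:~R) mx4_1 mx4_scale.
    by congr (mx4 R _); vm_compute.
  by rewrite diagonal_actionZ diagonal_action1 -scalemxAr mulmx1 scaleN1r scalerN opprK.
have rodd : odd (\rank (action_rows t q)) by rewrite rO.
have [] := restricted_parity n_gt0 m_gt0 q_cc t_anti rodd K_anti ZK _ _ eS eL; rewrite ?GH //.
by move=> ? ? ? e4; split=> //; rewrite e4 rO -subnDA.
Qed.

Lemma in_standard_plane_pid : in_standard_plane q ->
  diagonal_action n (mx4 R (ipid 2)) *m q = q.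
Proof.
move=> qs; apply/colP => k; have [j r] := mxtens_indexP k.
have e : body (diagonal_action n (mx4 R (ipid 2)) *m q) j r 0 = body q j r 0.
  rewrite body_action -pid_mx4 pid_mx_mul_entry; case: ltnP => h; rewrite ?mul1r ?mul0r //.
  by rewrite qs.
by move: e; rewrite !mxE.
Qed.

(** The omitted rotation (3,4) annihilates [q], so the five listed ones span the whole orbit
    tangent, of dimension 3 or 5. *)
Lemma standard_rotations_rank : in_standard_plane q ->
  \rank (action_rows (standard_rotations R) q) =
  (if \rank (config q) <= 1 then 3 else 5)%N.
Proof.
move=> qs; have := orbit_rank_cases (q_neq0 q_cc).
rewrite (in_standard_plane_rank qs) => <-.
have k34 : diagonal_action n (Krot R 3 4) *m q = 0.
  rewrite -(in_standard_plane_pid qs) mulmxA -diagonal_actionM Krot_mx4 mx4_mul.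
  rewrite (_ : imul _ _ = iscale 0 (ipid 4)); last by vm_compute.
  by rewrite -mx4_scale scale0r -[0](scale0r 0) diagonal_actionZ scale0r mul0mx.
apply/eqmx_rank/andP; split; apply/row_subP => -[i hi].
  have hi' : (i < 6)%N by apply: leq_trans hi _.
  have -> : row (Ordinal hi) (action_rows (standard_rotations R) q) =
      row (Ordinal hi') (orbit_rows q).
    by rewrite !rowK; move: hi hi'; case: i => [|[|[|[|[|//]]]]].
  exact: row_sub.
have [h5|h5] := ltnP i 5; last first.
  have -> : row (Ordinal hi) (orbit_rows q) = 0.
    by rewrite rowK; move: hi h5; case: i => [|[|[|[|[|[|//]]]]]] //= _ _; rewrite k34 trmx0.
  exact: sub0mx.
have -> : row (Ordinal hi) (orbit_rows q) =
    row (Ordinal (h5 : (i < size (standard_rotations R))%N))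
      (action_rows (standard_rotations R) q).
  by rewrite !rowK; move: hi h5; case: i => [|[|[|[|[|//]]]]].
exact: row_sub.
Qed.

Definition iunit i : seq (seq int) := imx (fun a b => ((a == i) && (b == i))%:Z).

(** H adds U M to the Hessian in all directions, G only in the horizontal ones. Both commute with
    matrices acting on the vertical plane, so modulo 2 only the horizontal part counts, where they
    agree. *)
Lemma planar_parity : planar_RE m q -> in_standard_plane q ->
  [/\ B3^T = B3,
      odd (neg_eigenvalues B3) = ~~ odd (n_minus m q + n_zero m q),
      odd (\rank B3) = ~~ odd (n_zero m q)
    & (d + d = 8 * n - 10 -
        2 * (if \rank (config q) <= 1 then 3 else 5))%N].
Proof.
move=> pl qs; pose t := standard_rotations R.
pose ts := [seq ikrot p.1 p.2 | p <- planar_pairs].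
have et : t = map (mx4 R) ts.
  by rewrite /t /standard_rotations /ts -map_comp; apply: eq_map => p; apply: Krot_mx4.
have e1 : 1%:M :: t = map (mx4 R) (ipid 4 :: ts) by rewrite /= -mx4_1 et.
have t_anti i : (nth 0 t i)^T = - nth 0 t i.
  by rewrite et; apply: nth_antisym; vm_compute.
have rO := standard_rotations_rank qs.
pose K := Ks m q.
have eL : block_mx K (invmx M) D K *m S = S *m L3.
  by move: LS; rewrite /Lstar /Kstar asboolT.
have eS : symplectic_basis S (omega_orth (E1 m + action_span m (1%:M :: t) q)%VS).
  by move: S_basis; rewrite /E3 /E2 asboolT.
have K_anti : K^T = - K.
  by rewrite /K Ks_action linearZ /= trmx_action Krot_antisym -scaleN1r
    diagonal_actionZ scaleN1r scalerN.
set Z := kermx (M *m (col_mx (repeat_mx R n)^T (action_rows (1%:M :: t) q))^T).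
have stab a : istable a (ipid 2) (ipid 4 :: ts) ->
    (Z *m diagonal_action n (mx4 R a) <= Z)%MS.
  rewrite /Z e1; apply: complement_stable; exact: in_standard_plane_pid.
(* Identities between diagonal actions become integer matrix identities, decided by [vm_compute]. *)
pose act a := diagonal_action n (mx4 R a).
have actM a b : act a *m act b = act (imul a b) by rewrite /act -diagonal_actionM mx4_mul.
have actD a b : act a + act b = act (iadd a b) by rewrite /act -diagonal_actionD mx4_add.
have actN a : - act a = act (iscale (-1) a).
  by rewrite /act -mx4_opp -[- mx4 _ _]scaleN1r diagonal_actionZ scaleN1r.
have actT a : (act a)^T = act (itr a) by rewrite /act trmx_action mx4_tr.
have act1 : 1%:M = act (ipid 4) by rewrite /act -mx4_1 diagonal_action1.
have act0 : 0 = act (ipid 0).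
  by rewrite /act -mx4_0 -[0 in RHS](scale0r 0) diagonal_actionZ scale0r.
(* [iunit] numbers coordinates from 0, [ikrot] from 1. *)
pose e3 := iunit 2; pose e4 := iunit 3; pose k34 := ikrot 3 4.
have ZK : (Z *m K <= Z)%MS.
  rewrite /K Ks_action Krot_mx4 -scalemxAr scalemx_sub //; apply: stab.
  by vm_compute.
have qP : act (ipid 2) *m q = q by apply: in_standard_plane_pid.
have actq0 a : imul a (ipid 2) = ipid 0 -> forall j, mx4 R a *m body q j = 0.
  move=> a0 j; rewrite -body_action -qP mulmxA -/(act a) actM a0 -act0 mul0mx.
  by apply/colP => r; rewrite !mxE.
have Dcomm a : imul a (ipid 2) = ipid 0 -> imul (itr a) (ipid 2) = ipid 0 ->
    D *m act a = act a *m D.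
  move=> a0 ta0; have [ncol _ _ _] := q_cc; rewrite /D hessianE //.
  by apply: hessmx_action; [apply: actq0 | rewrite mx4_tr; apply: actq0].
have Mcomm a : M *m act a = act a *m M by apply: massmx_action.
pose G := D - K *m M *m K.
have GE : G = D + potential m q *: (M *m act (ipid 2)).
  rewrite /G /K Ks_action gyroscopic_form Krot_mx4 diagonal_actionM -/(act _) actM.
  rewrite (_ : imul _ _ = iscale (-1) (ipid 2)); last by vm_compute.
  by rewrite -actN mulmxN scalerN opprK.
have HE : H = D + potential m q *: M by [].
have Hcomm a : imul a (ipid 2) = ipid 0 -> imul (itr a) (ipid 2) = ipid 0 ->
    H *m act a = act a *m H.
  move=> a0 ta0; rewrite HE mulmxDl mulmxDr Dcomm //; congr (_ + _).
  by rewrite -scalemxAl -scalemxAr Mcomm.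
have Gcomm a : imul a (ipid 2) = ipid 0 -> imul (itr a) (ipid 2) = ipid 0 ->
    imul (ipid 2) a = ipid 0 -> G *m act a = act a *m G.
  move=> a0 ta0 b0; rewrite GE mulmxDl mulmxDr Dcomm //; congr (_ + _).
  rewrite -scalemxAl -scalemxAr mulmxA -Mcomm -!mulmxA !actM a0 b0.
  by rewrite -act0.
have H_sym : H^T = H := hess_form_sym q_cc.
have G_sym : G^T = G.
  have D_sym : D^T = D.
    have [ncol _ _ _] := q_cc; rewrite /D (hessianE _ ncol).
    exact: hessmx_sym.
  by rewrite GE linearD /= linearZ /= trmx_mul actT massmx_sym D_sym -Mcomm.
have PE : 1%:M - act e3 - act e4 = act (ipid 2).
  rewrite act1 !actN !actD; congr act; by vm_compute.
have planarZ (A : 'M[R]_(n * 4)) : A^T = A ->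
    (forall a, imul a (ipid 2) = ipid 0 -> imul (itr a) (ipid 2) = ipid 0 ->
      imul (ipid 2) a = ipid 0 -> A *m act a = act a *m A) ->
    odd (ind A Z) = odd (ind A (Z *m act (ipid 2))).
  move=> A_sym Acomm; rewrite -PE.
  apply: (odd_ind_planar (J := act k34)) => //; rewrite ?actT ?actM ?actM ?actN ?actD ?act0;
    first [by congr act; vm_compute | by apply: Acomm; vm_compute
         | by apply: stab; vm_compute].
have PG : act (ipid 2) *m G = act (ipid 2) *m H.
  rewrite GE HE !mulmxDr; congr (_ + _); rewrite -!scalemxAr; congr (_ *: _).
  rewrite mulmxA -Mcomm -mulmxA actM; congr (_ *m act _); by vm_compute.
have commN (A : 'M[R]_(n * 4)) a : A *m act a = act a *m A -> - A *m act a = act a *m - A.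
  by move=> h; rewrite mulNmx mulmxN h.
have symN (A : 'M[R]_(n * 4)) : A^T = A -> (- A)^T = - A.
  by move=> h; rewrite linearN /= h.
have Hcomm' a : imul a (ipid 2) = ipid 0 -> imul (itr a) (ipid 2) = ipid 0 ->
    imul (ipid 2) a = ipid 0 -> H *m act a = act a *m H.
  by move=> a0 ta0 _; apply: Hcomm.
have G_parity : odd (ind G Z) = odd (ind H Z).
  rewrite (planarZ G G_sym Gcomm) (planarZ H H_sym Hcomm').
  by rewrite /ind -(mulmxA Z) PG (mulmxA Z).
have NG_parity : odd (ind (- G) Z) = odd (ind (- H) Z).
  rewrite (planarZ _ (symN _ G_sym) (fun a a0 ta0 b0 => commN _ _ (Gcomm a a0 ta0 b0))).
  rewrite (planarZ _ (symN _ H_sym) (fun a a0 ta0 b0 => commN _ _ (Hcomm' a a0 ta0 b0))).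
  by rewrite /ind !mulmxN -!(mulmxA Z) PG.
have rodd : odd (\rank (action_rows t q)) by rewrite rO; case: ifP.
have [e2 e3' e4' e5] :=
  restricted_parity n_gt0 m_gt0 q_cc t_anti rodd K_anti ZK G_parity NG_parity eS eL.
split; [exact: e2|exact: e3'|exact: e4'|idtac].
by rewrite e5 rO.
Qed.
End Cases.

Theorem theorem1p2 (R : realType) (n : nat) (m : 'I_n -> R)
    (q : 'cV[R]_(n * 4)) (d : nat) (B3 : 'M[R]_(d + d))
    (n_ge3 : (3 <= n)%N)
    (m_gt0 : forall i, 0 < m i)
    (q_cc : central_configuration m q)
    (q_coord : planar_RE m q -> in_standard_plane q)
    (hB3 : is_B3 m q B3) :
  ((~ planar q /\ morse_bott_nondegenerate m q) \/
   (morse_bott_degenerate m q /\ ~~ odd (n_zero m q)) ->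
   linearly_unstable B3)
  /\
  (~~ odd (morse_index B3
           (colker ((Jstd R d *m B3) ^+ (8 * n - 8 - 2 * kappa m q)%N))) ->
   [/\ ~~ odd (n_minus m q + n_zero m q) -> spectrally_unstable B3,
       morse_bott_nondegenerate m q -> ~ planar q -> ~~ odd (n_minus m q) ->
         spectrally_unstable B3
     & morse_bott_nondegenerate m q -> planar q -> odd (n_minus m q) ->
         spectrally_unstable B3]).
Proof.
have n_gt0 : (0 < n)%N by apply: leq_trans n_ge3.
have q0 := q_neq0 q_cc.
(* The exponent 8n - 8 - 2 kappa is the dimension of E3 in each case, large enough for the kernel of
   the power to be the generalized kernel. *)
have [symB oddneg oddrank dimB] : [/\ B3^T = B3,
    odd (neg_eigenvalues B3) = ~~ odd (n_minus m q + n_zero m q),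
    odd (\rank B3) = ~~ odd (n_zero m q)
  & (d + d <= 8 * n - 8 - 2 * kappa m q)%N].
  case: hB3 => S [L3 [S_basis LS ->]].
  have [pl|npl] := pselect (planar_RE m q).
    have qs := q_coord pl.
    have [? ? ? dd] := planar_parity n_gt0 m_gt0 q_cc S_basis LS pl qs.
    split=> //; rewrite dd /kappa; case: ifP => [r1|r1].
      by rewrite asboolT -?subnDA //; right; apply/collinearE.
    rewrite asboolF -?subnDA //.
    by case=> [/(_ pl) //|/collinearE]; rewrite r1.
  have [? ? ? dd] := nonplanar_parity n_gt0 m_gt0 q_cc S_basis LS npl.
  by split=> //; rewrite dd /kappa asboolT -?subnDA //; left.
have nondeg_nonplanar : morse_bott_nondegenerate m q -> ~ planar q -> ~~ odd (n_zero m q).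
  (* The orbit has dimension 6. *)
  move=> -> /planarE; rewrite dim_orbit_tangent orbit_rank_cases //.
  move=> /negP h2; rewrite (negbTE h2) ifN //.
  by apply: contra h2 => h1; apply: leq_trans h1 _.
have nondeg_planar : morse_bott_nondegenerate m q -> planar q -> odd (n_zero m q).
  (* The orbit has dimension 3 or 5. *)
  move=> -> /planarE h2; rewrite dim_orbit_tangent orbit_rank_cases // h2.
  by case: ifP.
split=> [hyp ls|even_index].
  have := linearly_stable_rank symB ls; rewrite oddrank negbK.
  by case: hyp => [[npl nd]|[_ /negbTE -> //]]; rewrite (negbTE (nondeg_nonplanar nd npl)).
have unstable : ~~ odd (n_minus m q + n_zero m q) -> spectrally_unstable B3.
  (* Stability would equate the parity of the index of [B3], here odd, with that on the generalized
     kernel, assumed even. *)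
  move=> ev ss; have := spectrally_stable_morse_index symB dimB ss.
  by rewrite oddneg ev (negbTE even_index).
split=> // nd pl nm; apply: unstable; rewrite oddD.
  by rewrite (negbTE nm) (negbTE (nondeg_nonplanar nd pl)).
by rewrite nm (nondeg_planar nd pl).
Qed.
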